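(* Given $\varepsilon>0$, a positive integer $K$, positive numbers $C_\beta,C_\varepsilon$ and $\sigma>1$, set $\beta_g=\frac{C_\beta}{\varepsilon}\frac{\sigma-1}{\sigma^K-1}$ and $\rho_k=\beta_k=\beta_g\sigma^k$ for $0\le k<K$. Choose $\{\varepsilon_k\}_{k=0}^{K-1}$ in one of two ways: (I) $\varepsilon_k=\frac\varepsilon2\frac{C_\varepsilon}{C_\beta}$ (for both $\mu=0$ and $\mu>0$); or (II) $\varepsilon_k=\frac{C_\varepsilon}{2}\frac{1}{\beta_k^{1/3}\sum_{t=0}^{K-1}\beta_t^{2/3}}$ if $\mu=0$, and $\varepsilon_k=\frac{C_\varepsilon}{2}\frac{1}{\sqrt{\beta_k}\sum_{t=0}^{K-1}\sqrt{\beta_t}}$ if $\mu>0$. Let $\{(x^k,z^k)\}_{k=0}^{K}$ be generated by the inexact augmented Lagrangian method (iALM, see context) with $z^0=0$ on the problem $\min_{x\in X}f_0(x)$ s.t. $f_i(x)\le0$, $i\in[m]$. Then $$\big|f_0(x^{K})-f_0(x^* )\big|\le\frac\varepsilon2\frac{C_\varepsilon}{C_\beta}+\frac{\varepsilon\sigma}{C_\beta(\sigma-1)}\big(2\|z^*\|+\sqrt{C_\varepsilon}\big)\left(5\|z^*\|+\frac72\sqrt{C_\varepsilon}\right),$$ $$\big\|[f(x^{K})]_+\big\|\le\frac{\varepsilon\sigma}{C_\beta(\sigma-1)}\left(5\|z^*\|+\frac72\sqrt{C_\varepsilon}\right).$$ Moreover, assuming $\mu\le\frac{L_0}4$ and with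 subproblems solved by Nesterov's optimal first-order method as described in the context, the total number $T_K$ of gradient evaluations satisfies the following. Under (I): if $\mu=0$, $$T_K\le\left\lceil2D\sqrt{\frac{C_\beta}{C_\varepsilon}}\left(K\sqrt{\frac{L_*}{\varepsilon}}+\frac{\sqrt{C_\beta H(\sigma-1)}}{\varepsilon(\sqrt\sigma-1)}\right)+K\right\rceil,$$ and if $\mu>0$, $$T_K\le\left\lceil2G_\varepsilon\left(K\sqrt{\frac{L_*}{\mu}}+\sqrt{\frac H\mu}\frac{\sqrt{C_\beta(\sigma-1)}}{\sqrt\varepsilon(\sqrt\sigma-1)}\right)+K\right\rceil,\quad G_\varepsilon=\log\frac{C_\beta D^2}{\varepsilon C_\varepsilon}+\log\left(L_*+\mu+\frac{H(C_\beta(\sigma-1)+\beta_g\varepsilon)}{\sigma\varepsilon}\right).$$ Under (II): if $\mu=0$, $$T_K\le\left\lceil2D\sqrt{\frac{C_\beta}{C_\varepsilon}}\left(\sqrt{\frac{L_*}{\varepsilon}}\frac{(\sigma-1)^{1/2}}{(\sigma^{1/6}-1)(\sigma^{2/3}-1)^{1/2}}+\frac{\sqrt{HC_\beta}(\sigma-1)}{\varepsilon(\sigma^{2/3}-1)^{3/2}}\right)+K\right\rceil,$$ and if $\mu>0$, $$T_K\le\left\lceil2G'_\varepsilon\left(K\sqrt{\frac{L_*}{\mu}}+\sqrt{\frac H\mu}\frac{\sqrt{C_\beta(\sigma-1)}}{\sqrt\varepsilon(\sqrt\sigma-1)}\right)+K\right\rceil,\quad G'_\varepsilon=G_\varepsilon+\log\frac{\sqrt{(\sigma-1)^2+\beta_g\varepsilon(\sigma-1)/C_\beta}}{\sigma-\sqrt\sigma},$$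 with $G_\varepsilon$ given by the same formula as under (I).
   Context: Setting: $[m]=\{1,\dots,m\}$; $X\subseteq\mathbb R^n$ is closed and convex; $f_0=g+h$ with $g$ convex differentiable and $h:\mathbb R^n\to\mathbb R\cup\{+\infty\}$ convex; $f_1,\dots,f_m$ convex differentiable; $\|\nabla g(\hat x)-\nabla g(\tilde x)\|\le L_0\|\hat x-\tilde x\|$ and $\|\nabla f_i(\hat x)-\nabla f_i(\tilde x)\|\le L_i\|\hat x-\tilde x\|$ for $\hat x,\tilde x\in\mathrm{dom}(h)\cap X$; $\mathrm{dom}(h)\cap X$ is bounded with diameter $D$. $g$ is strongly convex with modulus $\mu\ge0$ ($\mu=0$ meaning merely convex). There are no affine equality constraints. $f(x)=(f_1(x),\dots,f_m(x))$, $[\cdot]_+$ is the componentwise positive part, $\|\cdot\|$ the Euclidean norm. $B_1,\dots,B_m$ are constants with $\max(|f_i(x)|,\|\nabla f_i(x)\|)\le B_i$ and $|f_i(\hat x)-f_i(\tilde x)|\le B_i\|\hat x-\tilde x\|$ for $x,\hat x,\tilde x\in\mathrm{dom}(h)\cap X$. $(x^*,z^* )$ is a primal-dual solution (assumed to exist), i.e. a KKT point: $0\in\partial f_0(x^* )+N_X(x^* )+\sum_iz_i^*\nabla f_i(x^* )$ ($N_X$ the normal cone), $x^*\in X$, $z_i^*\ge0$, $f_i(x^* )\le0$, $z_i^*f_i(x^* )=0$ for all $i$. Constants: $\ell=(L_1,\dots,L_m)$, $H=\sum_{i=1}^mB_i(B_i+L_i)$, $L_*=L_0+\|\ell\|\big(2\|z^*\|+\sqrt{C_\varepsilon}\big)$.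 Augmented Lagrangian: $\mathcal L_\beta(x,z)=f_0(x)+\sum_{i=1}^m\psi_\beta(f_i(x),z_i)$, where $\psi_\beta(u,v)=uv+\frac\beta2u^2$ if $\beta u+v\ge0$, and $\psi_\beta(u,v)=-\frac{v^2}{2\beta}$ otherwise. iALM: from $x^0\in\mathrm{dom}(h)\cap X$ and $z^0$, for $k=0,1,\dots$: find $x^{k+1}\in X$ with $\mathcal L_{\beta_k}(x^{k+1},z^k)\le\min_{x\in X}\mathcal L_{\beta_k}(x,z^k)+\varepsilon_k$ (assumed to exist for every $k$); set $z_i^{k+1}=z_i^k+\rho_k\max\big(-\frac{z_i^k}{\beta_k},f_i(x^{k+1})\big)$, $i\in[m]$. Subproblem solver (Nesterov's optimal first-order method) for $\min\phi+\psi$, $\phi$ having gradient Lipschitz constant $L_\phi$ and strong convexity modulus $\mu\ge0$: $\hat w^0=w^0$, $\alpha_0=1$ if $\mu=0$ and $\alpha_0=\sqrt{\mu/L_\phi}$ if $\mu>0$, $q=\mu/L_\phi$, and iterate $w^{j+1}=\arg\min_w\langle\nabla\phi(\hat w^j),w\rangle+\frac{L_\phi}2\|w-\hat w^j\|^2+\psi(w)$, $\alpha_{j+1}=\frac{q-\alpha_j^2+\sqrt{(q-\alpha_j^2)^2+4\alpha_j^2}}2$, $\hat w^{j+1}=w^{j+1}+\frac{\alpha_j(1-\alpha_j)}{\alpha_j^2+\alpha_{j+1}}(w^{j+1}-w^j)$. In iALM iteration $k$ it is started at $w^0=x^k$ with $\phi=\mathcal L_{\beta_k}(\cdot,z^k)-h$,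 $\psi=h+\iota_X$ ($\iota_X$ the indicator function of $X$) and $L_\phi=L_0+\sum_{i=1}^m(\beta_kB_i(B_i+L_i)+L_i|z_i^k|)$, and is stopped once accuracy $\varepsilon_k$ is reached. Each of its iterations counts as one evaluation of the gradients of $g,f_1,\dots,f_m$.
   Formalization: For μ>0 the factors G_ε, G'_ε are replaced by max(0,G_ε), max(0,G'_ε), as the printed bounds can be negative; for the complexity part ∇φ is assumed L_φ-Lipschitz on a convex set containing dom(h)∩X and the extrapolated points used. *)

(* Defs.v *)
From HB Require Import structures.
From mathcomp Require Export all_boot all_order all_algebra.
From mathcomp Require Export all_classical all_reals all_analysis.
Export Order.TTheory GRing.Theory Num.Theory.
Export numFieldNormedType.Exports.

Set Implicit Arguments.
Unset Strict Implicit.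
Unset Printing Implicit Defensive.

Local Open Scope classical_set_scope.
Local Open Scope ring_scope.

Section Euclidean.
Context {R : realType} {n : nat}.
Implicit Types (x y v : 'rV[R]_n) (S : set 'rV[R]_n).

Definition dot x y : R := \sum_(j < n) x 0 j * y 0 j.

(* The library norm on ['rV[R]_n] is the sup norm; it induces the same topology
   and the same bounded sets. *)
Definition enorm x : R := Num.sqrt (\sum_(j < n) x 0 j ^+ 2).

Definition diameter S : R :=
  sup [set d | exists x y, [/\ S x, S y & d = enorm (x - y)]].

(* Only meaningful at points where [f] is differentiable. *)
Definition grad (f : 'rV[R]_n -> R) x : 'rV[R]_n :=
  \row_(j < n) 'D_(delta_mx 0 j) f x.

Definition lipschitz_grad S (f : 'rV[R]_n -> R) (L : R) : Prop :=
  forall x y, S x -> S y -> enorm (grad f x - grad f y) <= L * enorm (x - y).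

Definition convex_differentiable (f : 'rV[R]_n -> R) : Prop :=
  convex_function setT f /\ forall x, differentiable f x.

Definition strongly_convex (mu : R) (f : 'rV[R]_n -> R) : Prop :=
  forall x y (t : R), 0 <= t <= 1 ->
    f (t *: x + (1 - t) *: y) <=
      t * f x + (1 - t) * f y - mu / 2 * t * (1 - t) * enorm (x - y) ^+ 2.

Section ExtendedValued.
Local Open Scope ereal_scope.

(* Since [0 * +oo = 0], the cases [t = 0] and [t = 1] hold trivially. *)
Definition convex_ext (h : 'rV[R]_n -> \bar R) : Prop :=
  (forall x, h x != -oo) /\
  forall x y (t : R), (0 <= t <= 1)%R ->
    h (t *: x + (1 - t) *: y)%R <= t%:E * h x + (1 - t)%:E * h y.

Definition edom (h : 'rV[R]_n -> \bar R) : set 'rV[R]_n :=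
  [set x | h x < +oo].

Definition indicator S x : \bar R := if x \in S then 0 else +oo.

Definition subdifferential (F : 'rV[R]_n -> \bar R) x : set 'rV[R]_n :=
  [set s | F x \is a fin_num /\
           forall y, F x + (dot s (y - x))%:E <= F y].

Definition normal_cone S x : set 'rV[R]_n :=
  [set v | S x /\ forall y, S y -> (dot v (y - x) <= 0)%R].

Definition is_argmin (F : 'rV[R]_n -> \bar R) x : Prop :=
  forall y, F x <= F y.

Definition eps_solution S (F : 'rV[R]_n -> \bar R) (eps : R) : set 'rV[R]_n :=
  [set x | S x /\ F x <= ereal_inf (F @` S) + eps%:E].

End ExtendedValued.
End Euclidean.

Section AugmentedLagrangian.
Context {R : realType} {n m : nat}.
Variables (g : 'rV[R]_n -> R) (h : 'rV[R]_n -> \bar R)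
          (f : 'I_m -> 'rV[R]_n -> R) (X : set 'rV[R]_n).

Definition objective (x : 'rV[R]_n) : \bar R := ((g x)%:E + h x)%E.

Definition is_KKT (x : 'rV[R]_n) (z : 'rV[R]_m) : Prop :=
  [/\ exists s v, [/\ subdifferential objective x s, normal_cone X x v
                    & s + v + \sum_(i < m) z 0 i *: grad (f i) x = 0],
      X x
    & forall i, [/\ 0 <= z 0 i, f i x <= 0 & z 0 i * f i x = 0]].

Definition penalty (beta u v : R) : R :=
  if 0 <= beta * u + v then u * v + beta / 2 * u ^+ 2
  else - (v ^+ 2 / (2 * beta)).

Definition aug_lagrangian (beta : R) (z : 'rV[R]_m) (x : 'rV[R]_n) : \bar R :=
  (objective x + (\sum_(i < m) penalty beta (f i x) (z 0 i))%:E)%E.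

(* The augmented Lagrangian minus [h]. *)
Definition smooth_part (beta : R) (z : 'rV[R]_m) (x : 'rV[R]_n) : R :=
  g x + \sum_(i < m) penalty beta (f i x) (z 0 i).

Definition is_iALM (K : nat) (beta rho eps : nat -> R)
    (x : nat -> 'rV[R]_n) (z : nat -> 'rV[R]_m) : Prop :=
  (edom h `&` X) (x 0%N) /\
  forall k, (k < K)%N ->
    eps_solution X (aug_lagrangian (beta k) (z k)) (eps k) (x k.+1) /\
    forall i, z k.+1 0 i =
      z k 0 i + rho k * Num.max (- (z k 0 i / beta k)) (f i (x k.+1)).

End AugmentedLagrangian.

Section Nesterov.
Context {R : realType} {n : nat}.
Variables (phi : 'rV[R]_n -> R) (psi : 'rV[R]_n -> \bar R) (L mu : R).
Variable target : set 'rV[R]_n.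
Implicit Types w hw : nat -> 'rV[R]_n.

Fixpoint nesterov_alpha (j : nat) : R :=
  if j is j'.+1 then
    let a := nesterov_alpha j' in
    let c := mu / L - a ^+ 2 in
    (c + Num.sqrt (c ^+ 2 + 4 * a ^+ 2)) / 2
  else if mu == 0 then 1 else Num.sqrt (mu / L).

Definition running w (j : nat) : Prop :=
  forall i, (i <= j)%N -> ~ target (w i).

Definition stops_at w (j : nat) : Prop :=
  target (w j) /\ forall i, (i < j)%N -> ~ target (w i).

(* The iterates [w] and the extrapolated points [hw] are constrained only as
   long as [target] has not been reached; termination is not presupposed. *)
Definition nesterov_run w hw : Prop :=
  hw 0%N = w 0%N /\
  forall j, running w j ->
    let a := nesterov_alpha j in
    let a' := nesterov_alpha j.+1 in
    is_argmin (fun v => ((dot (grad phi (hw j)) v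
                          + L / 2 * enorm (v - hw j) ^+ 2)%:E + psi v)%E)
              (w j.+1) /\
    hw j.+1 = w j.+1 + (a * (1 - a) / (a ^+ 2 + a')) *: (w j.+1 - w j).

(* [phi] has [L]-Lipschitz gradient where the method needs it: on some convex
   set containing [S] and every extrapolated point at which the gradient is
   evaluated.  Those points need not belong to [S]. *)
Definition smooth_along (S : set 'rV[R]_n) w hw : Prop :=
  exists W : set 'rV[R]_n,
    [/\ convex_set W, S `<=` W, forall j, running w j -> W (hw j)
      & lipschitz_grad W phi L].

End Nesterov.

(* Main.v *)
(* With rho_k = beta_k the multiplier update is [z^k + beta_k f(x^{k+1})]_+, so
   comparing the inexact minimality of x^{k+1} with the saddle-point inequality
   at the KKT point (xs, zs) gives
     |z^{k+1} - zs|^2 <= |z^k - zs|^2 + 2 beta_k eps_k,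
   and both choices of eps_k are made so that 2 sum_k beta_k eps_k <= C_eps.
   Hence all multipliers are bounded, which yields the optimality and
   feasibility bounds through beta_{K-1} >= C_beta (sigma - 1) / (eps sigma), and
   also bounds the Lipschitz constant of the k-th subproblem by
   L_* + beta_k H.

   For the inner solver let D be the diameter of S = dom h /\ X and write gap_j
   for the suboptimality of w^j.  If mu = 0 the usual potential argument gives
   gap_j <= 2 L D^2 / (j+1)^2.  If mu > 0, with s = sqrt (mu / L), it gives
   gap_j <= (1 - s)^j L D^2; the logarithm in the theorem leaves no room for the
   extra factor 2, which is absorbed by combining this bound with
   gap_1 <= L D^2 / 4: as long as the method has not stopped, the tolerance is
   below sqrt (gap_1 gap_j) <= (L D^2 / 2) exp (- j s / 2).

   As h need not be lower semicontinuous the subproblems may have no minimizer;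
   all estimates are therefore stated against arbitrary points of S. *)
Require Import Defs.
From mathcomp Require Import ring lra.
Set Implicit Arguments.
Unset Strict Implicit.
Unset Printing Implicit Defensive.

Local Open Scope classical_set_scope.
Local Open Scope ring_scope.

(** * Euclidean geometry and the gradient inequality *)

Section DotProduct.
Context {R : realType} {n : nat}.
Implicit Types (x y v w : 'rV[R]_n) (a : R).

Lemma dotC x y : dot x y = dot y x.
Proof. by apply: eq_bigr => j _; rewrite mulrC. Qed.

Lemma dotDl x y v : dot (x + y) v = dot x v + dot y v.
Proof. by rewrite -big_split; apply: eq_bigr => j _; rewrite !mxE mulrDl. Qed.

Lemma dotZl a x v : dot (a *: x) v = a * dot x v.
Proof. by rewrite mulr_sumr; apply: eq_bigr => j _; rewrite !mxE mulrA. Qed.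

Lemma dotNl x v : dot (- x) v = - dot x v.
Proof. by rewrite -scaleN1r dotZl mulN1r. Qed.

Lemma dotDr x y v : dot v (x + y) = dot v x + dot v y.
Proof. by rewrite dotC dotDl !(dotC v). Qed.

Lemma dotZr a x v : dot v (a *: x) = a * dot v x.
Proof. by rewrite dotC dotZl (dotC v). Qed.

Lemma dotNr x v : dot v (- x) = - dot v x.
Proof. by rewrite dotC dotNl (dotC v). Qed.

Lemma dot0l x : dot 0 x = 0.
Proof. by rewrite -(scale0r (0 : 'rV[R]_n)) dotZl mul0r. Qed.

Lemma dot0r x : dot x 0 = 0.
Proof. by rewrite dotC dot0l. Qed.

Lemma dotBl x y v : dot (x - y) v = dot x v - dot y v.
Proof. by rewrite dotDl dotNl. Qed.

Definition dotE := (dotDl, dotDr, dotNl, dotNr, dotZl, dotZr).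

Lemma dot_ge0 x : 0 <= dot x x.
Proof. by apply: sumr_ge0 => j _; rewrite -expr2 sqr_ge0. Qed.

Lemma enormE x : enorm x = Num.sqrt (dot x x).
Proof. by congr Num.sqrt; apply: eq_bigr => j _; rewrite expr2. Qed.

Lemma enorm_ge0 x : 0 <= enorm x.
Proof. exact: sqrtr_ge0. Qed.

Lemma sqr_enorm x : enorm x ^+ 2 = dot x x.
Proof. by rewrite enormE sqr_sqrtr // dot_ge0. Qed.

Lemma enorm_le x y : (dot x x <= dot y y) = (enorm x <= enorm y).
Proof. by rewrite -!sqr_enorm ler_sqr // nnegrE enorm_ge0. Qed.

Lemma enorm_eq0 x : enorm x = 0 -> x = 0.
Proof.
rewrite enormE => /eqP; rewrite sqrtr_eq0 => x0.
apply/rowP => j; rewrite mxE; apply/eqP; rewrite -sqrf_eq0.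
have s0 : \sum_(j < n) x 0 j ^+ 2 = 0.
  apply/eqP; rewrite eq_le sumr_ge0 ?andbT => [|i _]; last exact: sqr_ge0.
  by move: x0; congr (_ <= 0); apply: eq_bigr => i _; rewrite expr2.
by have /psumr_eq0P/(_ s0 j isT)/eqP := fun i (_ : true) => sqr_ge0 (x 0 i).
Qed.

Lemma cauchy_schwarz x y : dot x y <= enorm x * enorm y.
Proof.
have [x0|xN] := eqVneq (enorm x) 0.
  by rewrite (enorm_eq0 x0) dot0l mulr_ge0 ?enorm_ge0.
have [y0|yN] := eqVneq (enorm y) 0.
  by rewrite (enorm_eq0 y0) dot0r mulr_ge0 ?enorm_ge0.
have xp : 0 < enorm x by rewrite lt0r xN enorm_ge0.
have yp : 0 < enorm y by rewrite lt0r yN enorm_ge0.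
have := dot_ge0 (enorm y *: x - enorm x *: y).
rewrite !dotE (dotC y x) -!sqr_enorm => h.
have : 0 <= (enorm x * enorm y) * (enorm x * enorm y - dot x y) by nra.
by rewrite pmulr_rge0 ?mulr_gt0 // subr_ge0.
Qed.

Lemma enormZ a x : enorm (a *: x) = `|a| * enorm x.
Proof.
by rewrite !enormE !dotE mulrA -expr2 sqrtrM ?sqr_ge0 // sqrtr_sqr.
Qed.

Lemma enormN x : enorm (- x) = enorm x.
Proof. by rewrite -scaleN1r enormZ normrN1 mul1r. Qed.

Lemma enormB x y : enorm (x - y) = enorm (y - x).
Proof. by rewrite -enormN opprB. Qed.

Lemma enormD x y : enorm (x + y) <= enorm x + enorm y.
Proof.
rewrite -ler_sqr ?nnegrE ?addr_ge0 ?enorm_ge0 // sqr_enorm !dotE (dotC y x).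
by rewrite -!sqr_enorm; have := cauchy_schwarz x y; nra.
Qed.

Lemma enorm_sub_sym x y v : enorm (x - v) <= enorm (x - y) + enorm (y - v).
Proof. by have := enormD (x - y) (y - v); rewrite addrA subrK. Qed.

Lemma ler_enorm x y : (forall j, `|x 0 j| <= `|y 0 j|) -> enorm x <= enorm y.
Proof.
move=> xy; rewrite -enorm_le; apply: ler_sum => j _.
by rewrite -!expr2 -real_normK ?num_real // -[leRHS]real_normK ?num_real // ler_sqr.
Qed.

End DotProduct.

Section Gradient.
Context {R : realType} {n : nat}.
Implicit Types (x y v : 'rV[R]_n) (f : 'rV[R]_n -> R).

(** [grad] records only partial derivatives; differentiability makes the directional derivative
    linear in the direction, so they determine it. *)
Lemma dot_grad f x v : differentiable f x -> dot (grad f x) v = 'D_v f x.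
Proof.
move=> df; rewrite deriveE // [v in RHS]row_sum_delta linear_sum.
by apply: eq_bigr => j _; rewrite mxE linearZ /= -deriveE // mulrC.
Qed.

(** Strong convexity on the segment from [x] to [y] bounds the difference quotient in direction [v];
    then [t] tends to 0 from the right. *)
Lemma grad_ineq mu f x y : strongly_convex mu f -> differentiable f x ->
  f x + dot (grad f x) (y - x) + mu / 2 * enorm (y - x) ^+ 2 <= f y.
Proof.
move=> fc df; rewrite dot_grad //.
set v := y - x; set c := mu / 2 * enorm v ^+ 2.
have dv : derivable f x v by apply: diff_derivable.
(* The bare quotient is at most [f y - f x - (1 - t) * c]; subtracting [t * c], which vanishes in
   the limit, makes the bound independent of [t]. *)
pose q t := t^-1 *: ((f \o shift x) (t *: v) - f x) - t * c.
have qcvg : q t @[t --> 0^'+] --> 'D_v f x - 0 * c.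
  apply: cvgB.
    by apply: cvg_dnbhs_at_right; exact: dv.
  by apply: cvg_at_right_filter; apply: cvgM; [exact: cvg_id|exact: cvg_cst].
rewrite mul0r subr0 in qcvg.
suff : 'D_v f x <= f y - f x - c by lra.
rewrite -(cvg_lim _ qcvg) //; apply: limr_le; first by apply/cvg_ex; exists ('D_v f x).
near=> t.
have t0 : 0 < t by near: t; exact: nbhs_right_gt.
have t1 : t < 1 by near: t; exact: nbhs_right_lt.
have := fc y x t; rewrite (ltW t0) (ltW t1) => /(_ isT).
have -> : t *: y + (1 - t) *: x = t *: v + x.
  by rewrite /v scalerBr scalerBl scale1r addrCA addrC.
rewrite /q /= -/v => h.
have : t * (t^-1 * (f (t *: v + x) - f x) - t * c) <= t * (f y - f x - c).
  rewrite mulrBr mulrA divff ?gt_eqF // mul1r /c; lra.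
by rewrite ler_pM2l.
Unshelve. all: by end_near.
Qed.

End Gradient.

(** * Smooth convex functions on a convex set *)

(** Replaces a limit when a segment is cut into [N.+1] pieces or a minimizer is perturbed by the
    fraction [N.+1%:R^-1]. *)
Lemma le_of_harmonic {R : realType} (a b C : R) :
  (forall N : nat, a <= b + C / N.+1%:R) -> a <= b.
Proof.
move=> h; apply/ler_addgt0Pr => e e0.
have [N CN] : exists N : nat, `|C| / e < N.+1%:R.
  exists (Num.truncn (`|C| / e)); apply: truncnS_gt; exact: divr_ge0 (ltW e0).
have N0 : 0 < N.+1%:R :> R by rewrite ltr0n.
apply: le_trans (h N) _; rewrite lerD2l ler_pdivrMr // mulrC.
move: CN; rewrite ltr_pdivrMr // => /ltW; exact: le_trans (ler_norm C).
Qed.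

Section ConvexSets.
Context {R : realType} {n : nat}.
Implicit Types (x y v w d : 'rV[R]_n) (W : set 'rV[R]_n).

Lemma convex_setP W x y (t : R) : convex_set W -> W x -> W y ->
  0 <= t <= 1 -> W (t *: x + (1 - t) *: y).
Proof.
move=> Wc /mem_set Wx /mem_set Wy /andP[t0 t1].
by have /set_mem := Wc x y (Itv01 t0 t1) Wx Wy.
Qed.

Lemma convex_set_segment W x y (t : R) : convex_set W -> W x -> W y ->
  0 <= t <= 1 -> W (x + t *: (y - x)).
Proof.
move=> Wc Wx Wy t01; have := convex_setP Wc Wy Wx t01; congr W.
by rewrite scalerBr scalerBl scale1r addrCA.
Qed.

End ConvexSets.

Section SmoothConvex.
Context {R : realType} {n : nat}.
Variables (phi : 'rV[R]_n -> R) (dphi : 'rV[R]_n -> 'rV[R]_n).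
Variables (W : set 'rV[R]_n) (L : R).
Hypothesis phi_grad : forall x y, phi x + dot (dphi x) (y - x) <= phi y.
Hypothesis W_convex : convex_set W.
Hypothesis dphi_lip : forall x y, W x -> W y ->
  enorm (dphi x - dphi y) <= L * enorm (x - y).
Implicit Types x y v w d u : 'rV[R]_n.

Lemma dphi_mono x y : 0 <= dot (dphi y - dphi x) (y - x).
Proof.
have := phi_grad x y; have := phi_grad y x.
by rewrite -(opprB y x) !dotE; lra.
Qed.

Lemma dphi_lip_dot x y d : W x -> W y ->
  dot (dphi x - dphi y) d <= L * enorm (x - y) * enorm d.
Proof.
move=> Wx Wy; apply: le_trans (cauchy_schwarz _ _) _.
by rewrite ler_wpM2r ?enorm_ge0 // dphi_lip.
Qed.

(* The segment is cut into [N] pieces, each bounded by the gradient at its far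
   end; letting [N] go to infinity recovers the factor 1/2. *)
Lemma descent x y : W x -> W y ->
  phi y <= phi x + dot (dphi x) (y - x) + L / 2 * enorm (y - x) ^+ 2.
Proof.
move=> Wx Wy; set v := y - x.
apply: (@le_of_harmonic _ _ _ (L / 2 * enorm v ^+ 2)) => N.
have N0 : N.+1%:R != 0 :> R by rewrite pnatr_eq0.
have Ni0 : 0 < N.+1%:R^-1 :> R by rewrite invr_gt0 ltr0n.
pose s i : R := i%:R / N.+1%:R.
have s01 i : (i <= N.+1)%N -> 0 <= s i <= 1.
  by move=> iN; rewrite divr_ge0 //= ler_pdivrMr ?ltr0n // mul1r ler_nat.
have sS j : s j.+1 = s j + N.+1%:R^-1 by rewrite /s -natr1; field.
have s0 : s 0%N = 0 by rewrite /s mul0r.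
have sN : s N.+1 = 1 by rewrite /s divff.
clearbody s.
have Ws i : (i <= N.+1)%N -> W (x + s i *: v).
  by move=> /s01; exact: convex_set_segment.
(* [s i * s i.+1] is a discrete square: one more piece adds [2 * N.+1%:R^-1 * s i.+1] and turns it
   into [s i.+1 * s i.+2]. At [i = N.+1] it exceeds 1 by [N.+1%:R^-1], which is the error term. *)
have key i : (i <= N.+1)%N -> phi (x + s i *: v) <=
    phi x + s i * dot (dphi x) v
    + L / 2 * enorm v ^+ 2 * (s i * s i.+1).
  elim: i => [_|i IH iN]; first by rewrite s0 !mul0r scale0r addr0 mulr0 !addr0.
  have := IH (ltnW iN); set a := x + s i *: v; set b := x + s i.+1 *: v => IHi.
  have abE : a - b = - N.+1%:R^-1 *: v.
    by rewrite /a /b opprD addrACA subrr add0r -scalerBl sS opprD addrA subrr add0r.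
  have := phi_grad b a; rewrite abE dotZr.
  have bxE : b - x = s i.+1 *: v by rewrite /b addrC addKr.
  have /andP[si0 _] := s01 _ iN.
  have := dphi_lip_dot v (Ws _ iN) Wx; rewrite -/b bxE enormZ ger0_norm //.
  rewrite dotBl -!mulrA -expr2 => h1 h2.
  have {}h1 := ler_wpM2l (ltW Ni0) h1.
  move: IHi h1 h2; rewrite (sS i.+1) !(sS i); move: (s i) (N.+1%:R^-1) => si r.
  by lra.
have := key N.+1 (leqnn _).
rewrite (sS N.+1) sN scale1r /v addrCA subrr addr0 -/v !mul1r.
by move: (N.+1%:R^-1) => r; lra.
Qed.

(** The descent inequality from [x] to [w] is set against the gradient inequalities from [x] to [y]
    and from [y] to [w]; all function values cancel. *)
Lemma grad_diff_dot x y w : W x -> W w ->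
  dot (dphi y - dphi x) (w - x) <=
    dot (dphi y - dphi x) (y - x) + L / 2 * enorm (w - x) ^+ 2.
Proof.
move=> Wx Ww; have := descent Wx Ww.
have := phi_grad x y; have := phi_grad y w.
have -> : w - y = (w - x) - (y - x) by rewrite opprB addrA subrK.
by rewrite !dotE; lra.
Qed.

(* Cocoercivity of [dphi] is not available since [W] need not be the whole
   space; this weaker inequality survives because [w - m] points into the
   triangle [x u w] along the whole segment from [x] to [m]. *)
Lemma grad_diff_midpoint x u w m : W x -> W u -> W w ->
  m = 2^-1 *: (x + u) ->
  dot (dphi m - dphi x) (w - m) <=
    dot (dphi m - dphi x) (m - x) + L / 2 * enorm (w - m) ^+ 2.
Proof.
move=> Wx Wu Ww mE; set v := m - x; set d := w - m.
have Wm : W m.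
  have -> : m = (2^-1 : R) *: x + (1 - 2^-1) *: u.
    by rewrite mE scalerDr; congr (_ + _ *: _); lra.
  by apply: convex_setP => //; lra.
apply: (@le_of_harmonic _ _ _ (L * enorm v * enorm d - L / 2 * enorm d ^+ 2)) => N.
have N0 : N.+1%:R != 0 :> R by rewrite pnatr_eq0.
have Ni0 : 0 < N.+1%:R^-1 :> R by rewrite invr_gt0 ltr0n.
pose s i : R := i%:R / N.+1%:R.
have s01 i : (i <= N.+1)%N -> 0 <= s i <= 1.
  by move=> iN; rewrite divr_ge0 //= ler_pdivrMr ?ltr0n // mul1r ler_nat.
have sS j : s j.+1 = s j + N.+1%:R^-1 by rewrite /s -natr1; field.
have s0 : s 0%N = 0 by rewrite /s mul0r.
have sN : s N.+1 = 1 by rewrite /s divff.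
have sE i : s i = i%:R / N.+1%:R by [].
clearbody s.
pose a i := x + s i *: v.
have Wa i : (i <= N.+1)%N -> W (a i).
  by move=> /s01; exact: convex_set_segment.
(* This is the point with parameter [s i] on the segment from [x] to [m + i%:R^-1 *: d], whose far
   end lies between [m] and [w]. The index 0 would put the far end beyond [w]. *)
have Wad i : (0 < i <= N.+1)%N -> W (a i + N.+1%:R^-1 *: d).
  move=> /andP[i0 /s01 iN].
  have Wmd : W (m + i%:R^-1 *: d).
    apply: convex_set_segment => //; rewrite invr_ge0 ler0n /=.
    by rewrite invf_le1 ?ltr0n // ler1n.
  have := convex_set_segment W_convex Wx Wmd iN; congr W.
  rewrite /a -[in RHS]addrA; congr (_ + _); rewrite addrAC -/v scalerDr; congr (_ + _).
  by rewrite scalerA sE; congr (_ *: _); rewrite mulrAC divff ?mul1r // pnatr_eq0 -lt0n.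
have aS i : a i.+1 - a i = N.+1%:R^-1 *: v.
  by rewrite /a opprD addrACA subrr add0r -scalerBl sS addrAC subrr add0r.
(* The sum starts at [a 1] because the perturbed point at [a 0] may leave [W]. The missing first
   piece is handled by monotonicity in direction [v] and by the Lipschitz bound in direction [d], at
   a cost of order [N.+1%:R^-1]. *)
have key i : (i < N.+1)%N -> dot (dphi (a i.+1) - dphi (a 1%N)) d <=
    dot (dphi (a i.+1) - dphi (a 1%N)) v + s i * (L / 2 * enorm d ^+ 2).
  elim: i => [_|i IH iN]; first by rewrite subrr !dot0l s0 !mul0r addr0.
  have {IH} := IH (ltnW iN).
  have := grad_diff_dot (a i.+2) (Wa _ (ltnW iN)) (Wad i.+1 (ltnW iN)).
  rewrite aS [_ + _ - _]addrC addKr enormZ gtr0_norm // (sS i).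
  rewrite exprMn [_ ^-1 ^+ 2]expr2 !dotZr.
  have -> p q : p + L / 2 * (N.+1%:R^-1 * N.+1%:R^-1 * q) =
     p + N.+1%:R^-1 * (L / 2 * (N.+1%:R^-1 * q)) by ring.
  rewrite -mulrDr ler_pM2l // !dotBl; move: (N.+1%:R^-1) => r; lra.
have a0 : a 0%N = x by rewrite /a s0 scale0r addr0.
have aN : a N.+1 = m by rewrite /a sN scale1r /v addrC subrK.
have := key N (leqnn _); rewrite aN.
have := dphi_mono (a 0%N) (a 1%N); rewrite aS dotZr pmulr_rge0 // a0.
have := dphi_lip_dot d (Wa 1%N isT) Wx.
have -> : a 1%N - x = N.+1%:R^-1 *: v by rewrite -{1}a0 aS.
rewrite enormZ gtr0_norm //.
have -> : s N = 1 - N.+1%:R^-1 by apply/eqP; rewrite eq_sym subr_eq -sS sN.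
rewrite !dotBl; move: (N.+1%:R^-1) => r; lra.
Qed.

End SmoothConvex.

(** * Proximal gradient steps and accelerated rates *)

Section ProximalStep.
Context {R : realType} {n : nat}.
Variables (phi hr : 'rV[R]_n -> R) (dphi : 'rV[R]_n -> 'rV[R]_n).
Variables (S W : set 'rV[R]_n) (L mu : R).
Hypothesis mu_ge0 : 0 <= mu.
Hypothesis L_ge0 : 0 <= L.
Hypothesis phi_strong : forall x y,
  phi x + dot (dphi x) (y - x) + mu / 2 * enorm (y - x) ^+ 2 <= phi y.
Hypothesis W_convex : convex_set W.
Hypothesis dphi_lip : forall x y, W x -> W y ->
  enorm (dphi x - dphi y) <= L * enorm (x - y).
Hypothesis S_convex : forall x y (t : R), S x -> S y -> 0 <= t <= 1 ->
  S (t *: x + (1 - t) *: y).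
Hypothesis SW : S `<=` W.
Hypothesis hr_convex : forall x y (t : R), S x -> S y -> 0 <= t <= 1 ->
  hr (t *: x + (1 - t) *: y) <= t * hr x + (1 - t) * hr y.
Implicit Types (x y p u w : 'rV[R]_n).

Definition prox_step y p := S p /\ forall v, S v ->
  dot (dphi y) p + L / 2 * enorm (p - y) ^+ 2 + hr p <=
  dot (dphi y) v + L / 2 * enorm (v - y) ^+ 2 + hr v.

Let F x := phi x + hr x.

Let phi_grad x y : phi x + dot (dphi x) (y - x) <= phi y.
Proof.
apply: le_trans (phi_strong x y); rewrite lerDl mulr_ge0 ?sqr_ge0 //.
by rewrite divr_ge0.
Qed.

(** The minimized model has modulus [L], so leaving its minimizer costs [L / 2] times the squared
    distance. Proved by comparing [p] with [t *: v + (1 - t) *: p], dividing by [t] and letting [t]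
    tend to 0. *)
Lemma three_point y p v : prox_step y p -> S v ->
  dot (dphi y) p + L / 2 * enorm (p - y) ^+ 2 + hr p + L / 2 * enorm (v - p) ^+ 2
  <= dot (dphi y) v + L / 2 * enorm (v - y) ^+ 2 + hr v.
Proof.
move=> [Sp pmin] Sv; apply: (@le_of_harmonic _ _ _ (L / 2 * enorm (v - p) ^+ 2)) => N.
have N0 : 0 < N.+1%:R^-1 :> R by rewrite invr_gt0 ltr0n.
have N1 : N.+1%:R^-1 <= 1 :> R by rewrite invf_le1 ?ltr0n // ler1n.
move: (N.+1%:R^-1) N0 N1 => t t0 t1.
have t01 : 0 <= t <= 1 by rewrite ltW.
have := le_trans (pmin _ (S_convex Sv Sp t01)) (lerD (lexx _) (hr_convex Sv Sp t01)).
rewrite !sqr_enorm !dotE (dotC p v) (dotC y v) (dotC p y) => h.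
by rewrite -(ler_pM2l t0); lra.
Qed.

(** Basic inequality of the accelerated method: [three_point] at [a *: u + (1 - a) *: w], descent
    from [y] to [p], and the strong gradient inequality at [y] averaged over [u] and [w] with
    weights [a] and [1 - a]. *)
Lemma prox_descent y p w u (a : R) : W y -> prox_step y p -> S w -> S u ->
  0 <= a <= 1 ->
  F p - F u + L / 2 * enorm (a *: u + (1 - a) *: w - p) ^+ 2 <=
  (1 - a) * (F w - F u)
  + (L - mu) / 2 * enorm (a *: u + (1 - a) *: w - y) ^+ 2
  - mu / 2 * (a * (1 - a)) * enorm (w - u) ^+ 2.
Proof.
move=> Wy yp Sw Su a01; have [Sp _] := yp.
have /andP[a0 a1] := a01; have b0 : 0 <= 1 - a by lra.
have h1 := three_point yp (S_convex Su Sw a01).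
have h2 := descent phi_grad W_convex dphi_lip Wy (SW Sp).
have h3 := ler_wpM2l a0 (phi_strong y u).
have h4 := ler_wpM2l b0 (phi_strong y w).
have h5 := hr_convex Su Sw a01.
move: h1 h2 h3 h4 h5; rewrite /F !sqr_enorm !dotE.
rewrite (dotC p u) (dotC p w) (dotC p y) (dotC y u) (dotC y w) (dotC w u).
by lra.
Qed.

Lemma prox_first_step x p u : prox_step x p -> S x -> S u ->
  F p - F u <= (L - mu) / 2 * enorm (u - x) ^+ 2 - L / 2 * enorm (u - p) ^+ 2.
Proof.
move=> xp Sx Su.
have := prox_descent (a := 1) (SW Sx) xp Su Su; rewrite ler01 lexx => /(_ isT).
by rewrite !scale1r subrr scale0r !addr0; lra.
Qed.

(** Linearizing at the midpoint [m] of [x] and [u] rather than at [x] gains the factor 2: by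
    [grad_diff_midpoint] the gradient terms cost only [L / 2 * enorm (p - m) ^+ 2], and the
    parallelogram law for [p - x] and [p - u] absorbs all terms in [p]. *)
Lemma prox_gap_quarter x p u : prox_step x p -> S x -> S u ->
  F p - F u <= L / 4 * enorm (u - x) ^+ 2.
Proof.
move=> xp Sx Su; have [Sp _] := xp.
pose m : 'rV[R]_n := 2^-1 *: (x + u).
have Wm : W m.
  have -> : m = (2^-1 : R) *: x + (1 - 2^-1) *: u.
    by rewrite /m scalerDr; congr (_ + _ *: _); lra.
  by apply: SW; apply: S_convex => //; lra.
have h1 := three_point xp Su.
have h2 := descent phi_grad W_convex dphi_lip Wm (SW Sp).
have h3 := phi_grad m u.
have h4 := grad_diff_midpoint phi_grad W_convex dphi_lip
  (SW Sx) (SW Su) (SW Sp) (erefl m).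
move: (dphi m) h1 h2 h3 h4 => gm; rewrite /F /m !sqr_enorm !dotE.
rewrite (dotC p u) (dotC p x) (dotC x u).
by lra.
Qed.

Section Iterates.
Variables (w hw : nat -> 'rV[R]_n) (al : nat -> R) (J : nat).
Hypothesis hw0 : hw 0%N = w 0%N.
Hypothesis Sw0 : S (w 0%N).
Hypothesis Whw : forall i, (i < J)%N -> W (hw i).
Hypothesis w_prox : forall i, (i < J)%N -> prox_step (hw i) (w i.+1).
Hypothesis hwS : forall i, (i.+1 < J)%N -> hw i.+1 = w i.+1 +
  (al i * (1 - al i) / (al i ^+ 2 + al i.+1)) *: (w i.+1 - w i).

Let Sw i : (i <= J)%N -> S (w i).
Proof. by case: i => // i iJ; case: (w_prox iJ). Qed.

(** The usual Lyapunov function: with [v = x + a^-1 *: (p - x)] the squared norm equals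
    [a ^+ 2 * enorm (u - v) ^+ 2]. This form avoids the auxiliary sequence [v]. *)
Let potential (a : R) (x p u : 'rV[R]_n) :=
  F p - F u + L / 2 * enorm (a *: u + (1 - a) *: x - p) ^+ 2.

Let gap_le_potential a x p u : F p - F u <= potential a x p u.
Proof. by rewrite lerDl mulr_ge0 ?sqr_ge0 // divr_ge0. Qed.

(** Step [j.+1] multiplies the potential by at most [1 - al j.+1], which is the ratio of
    [al j.+1 ^+ 2] to [al j ^+ 2], so the bound telescopes. *)
Lemma accelerated_rate u j : S u -> mu = 0 -> al 0%N = 1 ->
  (forall i, 0 < al i <= 1) ->
  (forall i, al i.+1 ^+ 2 = (1 - al i.+1) * al i ^+ 2) -> (j < J)%N ->
  F (w j.+1) - F u <= L / 2 * al j ^+ 2 * enorm (u - w 0%N) ^+ 2.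
Proof.
move=> Su mu0 al0 al01 alS.
suff: (j < J)%N -> potential (al j) (w j) (w j.+1) u <=
    L / 2 * al j ^+ 2 * enorm (u - w 0%N) ^+ 2.
  by move=> H /H; apply: le_trans; exact: gap_le_potential.
elim: j => [|j IH] jJ.
  have := prox_descent (a := 1) (Whw jJ) (w_prox jJ) Sw0 Su.
  rewrite ler01 lexx => /(_ isT); rewrite /potential al0 hw0 mu0.
  by rewrite subrr !scale0r !addr0 scale1r; lra.
have {IH} := IH (ltnW jJ); have := hwS jJ; have := alS j.
have /andP[a0 a1] := al01 j; have /andP[b0 b1] := al01 j.+1.
have b01 : 0 <= al j.+1 <= 1 by rewrite ltW.
have := prox_descent (Whw jJ) (w_prox jJ) (Sw (ltnW jJ)) Su b01.
move: (al j) (al j.+1) a0 a1 b0 b1 {b01} => a b a0 a1 b0 b1 h bE hwE.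
(* The extrapolation coefficient is chosen for this identity: the vector in the new inequality is a
   multiple of the one in the old potential, and [(b / a) ^+ 2 = 1 - b]. *)
have hE : b *: u + (1 - b) *: w j.+1 - hw j.+1 =
    (b / a) *: (a *: u + (1 - a) *: w j - w j.+1).
  have thE : a * (1 - a) / (a ^+ 2 + b) = b * (1 - a) / a.
    have aN0 : a != 0 by rewrite gt_eqF.
    have abN0 : a ^+ 2 + b != 0 by rewrite gt_eqF // addr_gt0 // exprn_gt0.
    apply/eqP; rewrite eqr_div // -!mulrA [X in X == _]mulrC.
    by apply/eqP; ring: bE.
  by rewrite hwE thE; apply/rowP => i; rewrite !mxE; field; rewrite gt_eqF.
move: h; rewrite hE enormZ exprMn real_normK ?num_real // exprMn exprVn bE mulfK; last first.
  by rewrite gt_eqF // exprn_gt0.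
have c0 : 0 <= 1 - b by lra.
by rewrite mu0 /potential => h /(ler_wpM2l c0); lra.
Qed.

(** The potential contracts by [1 - s] at every step. After the first step all squares cancel
    because [mu = s ^+ 2 * L], leaving only an inner product; this keeps the constant at [L] times a
    product of two distances. *)
Lemma strong_rate u j (s : R) : S u -> 0 < s <= 1 -> mu = s ^+ 2 * L ->
  (forall i, al i = s) -> (j < J)%N ->
  F (w j.+1) - F u <= (1 - s) ^+ j.+1 * (L * (enorm (u - w 0%N) * enorm (w 1%N - w 0%N))).
Proof.
move=> Su /andP[s0 s1] muE alE.
suff: (j < J)%N -> potential s (w j) (w j.+1) u <=
    (1 - s) ^+ j.+1 * (L * dot (u - w 0%N) (w 1%N - w 0%N)).
  move=> H /H; have c0 : 0 <= 1 - s by lra.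
  move=> {}H; apply: le_trans (gap_le_potential _ _ _ _) (le_trans H _).
  by rewrite ler_wpM2l ?exprn_ge0 // ler_wpM2l // cauchy_schwarz.
elim: j => [|j IH] jJ.
  have := w_prox jJ; rewrite hw0 => /prox_first_step/(_ Sw0 Su).
  rewrite muE /potential expr1 !sqr_enorm !dotE.
  rewrite (dotC (w 1%N) u) (dotC (w 1%N) (w 0%N)) (dotC u (w 0%N)).
  by lra.
have {IH} := IH (ltnW jJ); have := hwS jJ; rewrite !alE.
have s01 : 0 <= s <= 1 by rewrite ltW.
have := prox_descent (Whw jJ) (w_prox jJ) (Sw (ltnW jJ)) Su s01.
have c0 : 0 <= 1 - s by lra.
move=> h hwE /(ler_wpM2l c0) IH.
rewrite [(1 - s) ^+ j.+2]exprS -[leRHS]mulrA; apply: le_trans _ IH.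
set th := _ / _ in hwE; have thE : th = (1 - s) / (1 + s).
  rewrite /th; field; rewrite !lt0r_neq0 //; nra.
apply: le_trans h _.
(* In terms of [A] and [d] both sides are quadratic forms whose difference is a multiple of
   [dot d d], nonnegative because [th <= 1 - s]. *)
pose A := u - w j.+1; pose d := w j.+1 - w j.
have -> : s *: u + (1 - s) *: w j.+1 - hw j.+1 = s *: A - th *: d.
  by rewrite hwE; apply/rowP => i; rewrite !mxE; ring.
have E2 : s *: u + (1 - s) *: w j - w j.+1 = s *: A - (1 - s) *: d.
  by apply/rowP => i; rewrite !mxE; ring.
rewrite /potential E2 -(enormN (w j.+1 - u)) opprB -/A -subr_ge0.
rewrite !sqr_enorm; move: A d {E2 hwE} => A d; rewrite !dotE (dotC d A) muE.
have thle : 0 <= (1 - s) - th.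
  by rewrite subr_ge0 thE ler_pdivrMr; nra.
set rhs := (X in 0 <= X).
suff -> : rhs = L / 2 * ((1 - s) ^+ 2 * ((1 - s) - th)) * dot d d.
  by rewrite !mulr_ge0 ?dot_ge0 ?sqr_ge0 // invr_ge0.
by rewrite /rhs thE; field; rewrite lt0r_neq0 //; nra.
Qed.

End Iterates.
End ProximalStep.

(** * Stopping time of the accelerated method *)

Section NesterovAlpha.
Context {R : realType}.
Implicit Types L mu : R.

(** [Num.sqrt (mu / L)] is a fixed point of the recursion, since there [c] vanishes. *)
Lemma nesterov_alpha_strong L mu j : 0 < mu -> 0 < L ->
  nesterov_alpha L mu j = Num.sqrt (mu / L).
Proof.
move=> mu0 L0; elim: j => [|j IH] /=; first by rewrite gt_eqF.
rewrite IH sqr_sqrtr ?divr_ge0 ?ltW // subrr expr0n add0r add0r.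
have s0 : 0 <= Num.sqrt (mu / L) by exact: sqrtr_ge0.
rewrite -[X in 4 * X](@sqr_sqrtr _ (mu / L)) ?divr_ge0 ?ltW //.
move: (Num.sqrt _) s0 => s s0.
have -> : 4 * s ^+ 2 = (2 * s) ^+ 2 by ring.
by rewrite sqrtr_sqr ger0_norm; [field|lra].
Qed.

(** For [mu = 0] each term [b] is the positive root of [b ^+ 2 = (1 - b) * a ^+ 2], with [a] the
    preceding term; the decay [2 / (j + 2)] follows from this equation by induction. *)
Lemma nesterov_alpha_convex L j : let a := nesterov_alpha L 0 in
  [/\ 0 < a j <= 1, a j.+1 ^+ 2 = (1 - a j.+1) * a j ^+ 2
    & a j * j.+2%:R <= 2].
Proof.
have aS i : nesterov_alpha L 0 i.+1 =
  (- nesterov_alpha L 0 i ^+ 2 + Num.sqrt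
    (nesterov_alpha L 0 i ^+ 2 ^+ 2 + 4 * nesterov_alpha L 0 i ^+ 2)) / 2.
  by rewrite /= mul0r sub0r sqrrN.
have eqS i : nesterov_alpha L 0 i.+1 ^+ 2 =
    (1 - nesterov_alpha L 0 i.+1) * nesterov_alpha L 0 i ^+ 2.
  rewrite aS; move: (nesterov_alpha _ _ _) => a.
  have D0 : 0 <= a ^+ 2 ^+ 2 + 4 * a ^+ 2.
    by rewrite addr_ge0 ?sqr_ge0 // pmulr_rge0 ?sqr_ge0.
  have := sqr_sqrtr D0.
  by move: (Num.sqrt _) => r; nra.
have a_gt0 i : 0 < nesterov_alpha L 0 i.
  elim: i => [|i]; first by rewrite /= eqxx.
  rewrite aS; move: (nesterov_alpha _ _ _) => a a0.
  have D0 : 0 <= a ^+ 2 ^+ 2 + 4 * a ^+ 2.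
    by rewrite addr_ge0 ?sqr_ge0 // pmulr_rge0 ?sqr_ge0.
  have := sqr_sqrtr D0.
  have := sqrtr_ge0 (a ^+ 2 ^+ 2 + 4 * a ^+ 2); move: (Num.sqrt _) => r r0 rE.
  have : a ^+ 2 < r.
    rewrite -ltr_sqr ?nnegrE ?sqr_ge0 // rE ltrDl mulr_gt0 // exprn_gt0 //.
  by lra.
move=> a; rewrite /a; split; last 1 first.
- elim: j => [|j]; first by rewrite /= eqxx mul1r.
  have := eqS j; have := a_gt0 j; have := a_gt0 j.+1.
  move: (nesterov_alpha L 0 j) (nesterov_alpha L 0 j.+1) => b c c0 b0 cE bj.
  (* With [d = j + 2], [b * d <= 2] and [c * (d + 1) > 2], the recursion would give
     [4 * d ^+ 2 < 4 * (d ^+ 2 - 1)]. *)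
  rewrite leNgt; apply/negP => cj.
  have [d [d2 d3 d4]] : exists d : R, [/\ j.+2%:R = d, j.+3%:R = d + 1 & 2 <= d].
    by exists j.+2%:R; rewrite natr1 ler_nat.
  move: bj cj; rewrite d2 d3 => bj cj.
  have c1 : 0 <= 1 - c by rewrite -(pmulr_lge0 _ (exprn_gt0 2 b0)) -cE sqr_ge0.
  have h1 : (b * d) ^+ 2 <= 4 by rewrite -[4](_ : 2 ^+ 2 = _) ?ler_sqr ?nnegrE //; nra.
  have h2 : 4 < (c * (d + 1)) ^+ 2 by nra.
  have h3 : c ^+ 2 * d ^+ 2 <= (1 - c) * 4.
    by rewrite cE -mulrA -exprMn ler_wpM2l.
  have h4 : (1 - c) * 4 * (d + 1) < 4 * (d - 1) by nra.
  have h5 : c ^+ 2 * d ^+ 2 * (d + 1) ^+ 2 < 4 * (d - 1) * (d + 1) by nra.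
  have h6 : 4 * d ^+ 2 < (c * (d + 1)) ^+ 2 * d ^+ 2 by nra.
  by nra.
- case: j => [|j]; first by rewrite /= eqxx ltr01 lexx.
  rewrite a_gt0 /= -subr_ge0 -(pmulr_lge0 _ (exprn_gt0 2 (a_gt0 j))).
  by rewrite -eqS sqr_ge0.
- exact: eqS.
Qed.

End NesterovAlpha.

Section StoppingTime.
Context {R : realType} {n : nat}.

(** If the target were never reached, an index beyond [M] would still be running. At the first hit
    [T] the index [T - 1] is running, hence at most [M]; the cases [T = 0] and [T = 1] are covered
    by the summand 1. *)
Lemma stops_of_bound (target : set 'rV[R]_n) (w : nat -> 'rV[R]_n) (M : R) :
  0 <= M ->
  (forall j, (0 < j)%N -> running target w j -> j%:R <= M) ->
  exists T, stops_at target w T /\ T%:R <= 1 + M.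
Proof.
move=> M0 HM.
have exT : exists T, (fun t => `[< target (w t) >]) T.
  apply: contrapT => /forallNP noT.
  pose j := (Num.truncn M).+1.
  have : running target w j by move=> i _ ti; apply: (noT i); apply/asboolP.
  by move=> /(HM j isT); rewrite leNgt truncnS_gt.
case: (ex_minnP exT) => t /asboolP tt tmin.
have tstop i : (i < t)%N -> ~ target (w i).
  by move=> it /asboolP/tmin; rewrite leqNgt it.
exists t; split=> //.
case: t {tt tmin} tstop => [_|[|t] tstop]; [by lra|by lra|].
by rewrite -natr1 addrC lerD2l; apply: HM => // i it; apply: tstop.
Qed.

End StoppingTime.

(** * Reduction of extended-valued problems to real inequalities on the domain *)

Section ExtendedObjective.
Context {R : realType} {n : nat}.
Variables (h : 'rV[R]_n -> \bar R) (X : set 'rV[R]_n).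
Hypothesis h_convex : convex_ext h.
Hypothesis X_convex : convex_set X.
Let S := edom h `&` X.
Implicit Types (x y u v : 'rV[R]_n).

Lemma edom_fin v : edom h v -> h v = (fine (h v))%:E.
Proof.
by move=> hv; rewrite fineK // fin_numE h_convex.1 -ltey.
Qed.

Lemma convex_edom x y (t : R) : S x -> S y -> 0 <= t <= 1 ->
  S (t *: x + (1 - t) *: y).
Proof.
move=> [hx Xx] [hy Xy] t01; split; last exact: convex_setP.
have /andP[t0 t1] := t01; rewrite /edom /=.
apply: le_lt_trans (h_convex.2 x y t t01) _.
by rewrite (edom_fin hx) (edom_fin hy) -!EFinM -EFinD ltry.
Qed.

Lemma fine_convex x y (t : R) : S x -> S y -> 0 <= t <= 1 ->
  fine (h (t *: x + (1 - t) *: y)) <= t * fine (h x) + (1 - t) * fine (h y).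
Proof.
move=> Sx Sy t01; have [hz _] := convex_edom Sx Sy t01.
rewrite -lee_fin -(edom_fin hz) EFinD !EFinM.
by rewrite -(edom_fin Sx.1) -(edom_fin Sy.1); exact: h_convex.2.
Qed.

(** Points where the value is [+oo] do not affect the infimum, and a point of [S] keeps it below
    [+oo]. Near-optimality thus becomes a family of real inequalities, with no minimizer
    involved. *)
Lemma eps_solutionP (F : 'rV[R]_n -> \bar R) (Fr : 'rV[R]_n -> R) (e : R) x :
  (forall v, S v -> F v = (Fr v)%:E) ->
  (forall v, ~ edom h v -> F v = +oo%E) -> S !=set0 ->
  (eps_solution X F e x <-> S x /\ forall u, S u -> Fr x <= Fr u + e).
Proof.
move=> FS FoS [a Sa]; split=> [[Xx Fx]|[Sx Fx]].
  have bound u : S u -> (F x <= (Fr u + e)%:E)%E.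
    move=> Su; apply: le_trans Fx _; rewrite EFinD leeD2r //.
    by rewrite -(FS _ Su); apply: ereal_inf_lbound; exists u => //; exact: Su.2.
  have Sx : S x.
    split=> //; apply: contrapT => hx.
    by have := bound _ Sa; rewrite (FoS _ hx).
  by split=> // u /bound; rewrite (FS _ Sx) lee_fin.
split; first exact: Sx.2.
rewrite (FS _ Sx) -leeBlDr //; apply: le_ereal_inf_tmp => _ [u Xu <-].
have [hu|hu] := pselect (edom h u); last by rewrite (FoS _ hu) leey.
by rewrite (FS u) // -EFinB lee_fin lerBlDr; apply: Fx.
Qed.

(** A finite value at some point of [S] forces the minimizer into [S], where the indicator
    vanishes. *)
Lemma argmin_prox_step phi L y p :
  is_argmin (fun v => ((dot (grad phi y) v + L / 2 * enorm (v - y) ^+ 2)%:E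
                       + (h v + indicator X v))%E) p -> S !=set0 ->
  prox_step (fine \o h) (grad phi) S L y p.
Proof.
move=> pmin [a Sa].
have indS v : X v -> indicator X v = 0%E.
  by move=> Xv; rewrite /indicator mem_set.
have psiS v : S v -> (h v + indicator X v)%E = (fine (h v))%:E.
  by move=> [hv Xv]; rewrite indS // adde0 -edom_fin.
have Sp : S p.
  have := pmin a; rewrite (psiS _ Sa) -EFinD => pa.
  have lt_p : (h p + indicator X p < +oo)%E.
    rewrite ltNge leye_eq; apply/negP => /eqP pE.
    by move: pa; rewrite pE addey // leye_eq.
  have Xp : X p.
    apply: contrapT => nXp; move: lt_p; rewrite /indicator memNset //.
    by rewrite addey ?ltxx ?h_convex.1.
  by split=> //; move: lt_p; rewrite indS // adde0.
split=> // v Sv; have := pmin v.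
by rewrite (psiS _ Sp) (psiS _ Sv) -!EFinD lee_fin.
Qed.

End ExtendedObjective.

Section NesterovComplexity.
Context {R : realType} {n : nat}.
Variables (phi : 'rV[R]_n -> R) (h Fe : 'rV[R]_n -> \bar R) (X : set 'rV[R]_n).
Variables (L mu e D : R) (w hw : nat -> 'rV[R]_n).
Hypothesis h_convex : convex_ext h.
Hypothesis X_convex : convex_set X.
Hypothesis mu_ge0 : 0 <= mu.
Hypothesis mu_le : mu <= L.
Hypothesis e_gt0 : 0 < e.
Let S := edom h `&` X.
Let F v := phi v + fine (h v).
Let target := eps_solution X Fe e.
Hypothesis phi_strong : forall x y,
  phi x + dot (grad phi x) (y - x) + mu / 2 * enorm (y - x) ^+ 2 <= phi y.
Hypothesis S_diam : forall x y, S x -> S y -> enorm (x - y) <= D.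
Hypothesis FeS : forall v, S v -> Fe v = (F v)%:E.
Hypothesis FeNS : forall v, ~ edom h v -> Fe v = +oo%E.
Hypothesis Sw0 : S (w 0%N).
Hypothesis w_run : nesterov_run phi (fun v => (h v + indicator X v)%E) L mu target w hw.
Hypothesis w_smooth : smooth_along phi L target S w hw.

Let L_ge0 : 0 <= L.
Proof. exact: le_trans mu_ge0 mu_le. Qed.

Let S_nonempty : S !=set0. Proof. by exists (w 0%N). Qed.

Let D_ge0 : 0 <= D.
Proof. by apply: le_trans (S_diam Sw0 Sw0); exact: enorm_ge0. Qed.

Let running_lt j i : running target w j -> (i <= j)%N -> running target w i.
Proof. by move=> rj ij k ki; apply: rj; apply: leq_trans ki ij. Qed.

Let w_prox j i : running target w j -> (i < j.+1)%N ->
  prox_step (fine \o h) (grad phi) S L (hw i) (w i.+1).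
Proof.
move=> rj ij; have [wmin _] := w_run.2 i (running_lt rj ij).
exact: argmin_prox_step wmin S_nonempty.
Qed.

Let w_hwS j i : running target w j -> (i.+1 < j.+1)%N ->
  let al := nesterov_alpha L mu in hw i.+1 = w i.+1 +
    (al i * (1 - al i) / (al i ^+ 2 + al i.+1)) *: (w i.+1 - w i).
Proof. by move=> rj ij; have [_ ->] := w_run.2 i (running_lt rj (ltnW ij)). Qed.

Let w_in j : running target w j -> S (w j.+1).
Proof. by move=> rj; have [] := w_prox rj (ltnSn j). Qed.

(** A point [u] witnessing that the tolerance is missed takes the place of a minimizer in the
    convergence rates. *)
Let running_gap j : running target w j.+1 ->
  exists2 u, S u & e < F (w j.+1) - F u.
Proof.
move=> rj; have := rj _ (leqnn _).
move=> nt; apply: contrapT => /forall2NP H; apply: nt.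
apply/(eps_solutionP e (w j.+1) FeS FeNS S_nonempty); split.
  by apply: w_in; exact: running_lt rj (leqnSn j).
move=> u Su; rewrite leNgt; apply/negP => lt_u.
by case: (H u) => //; apply; rewrite ltrBrDl.
Qed.

Let diam2 u : S u -> enorm (u - w 0%N) ^+ 2 <= D ^+ 2.
Proof. by move=> Su; rewrite ler_sqr ?nnegrE ?enorm_ge0 // S_diam. Qed.

(** While [w j.+1] misses the tolerance, [e < L / 2 * a ^+ 2 * D ^+ 2] with [a <= 2 / (j + 2)]; this
    is solved for the index. *)
Lemma nesterov_stops_convex : mu = 0 ->
  exists T, stops_at target w T /\ T%:R <= 1 + D * Num.sqrt (2 * L / e).
Proof.
move=> mu0; apply: stops_of_bound; first by rewrite mulr_ge0 ?sqrtr_ge0.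
move=> [//|j] _ rj; have [u Su eu] := running_gap rj.
have [W [Wc SW Whw Wlip]] := w_smooth.
have rj' : running target w j by exact: running_lt rj (leqnSn j).
have := accelerated_rate mu_ge0 L_ge0 phi_strong Wc Wlip (convex_edom h_convex X_convex)
  SW (fine_convex h_convex X_convex) w_run.1 Sw0
  (fun i (ij : (i < j.+1)%N) => Whw i (running_lt rj' ij))
  (fun i ij => w_prox rj' ij) (fun i ij => w_hwS rj' ij) Su mu0.
have al i := nesterov_alpha_convex L i.
have a00 : nesterov_alpha L 0 0 = 1 by rewrite /= eqxx.
rewrite mu0 => /(_ j a00) rate.
have {rate} := rate (fun i => let: And3 a _ _ := al i in a)
  (fun i => let: And3 _ a _ := al i in a) (ltnSn j).
have [/andP[a0 _] _ alj] := al j; move: a0 alj.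
move: (nesterov_alpha L 0 j) => a a0 aj rate.
have {rate} lt1 : e < L / 2 * a ^+ 2 * D ^+ 2.
  apply: lt_le_trans eu (le_trans rate _); rewrite ler_wpM2l ?diam2 //.
  by rewrite mulr_ge0 ?sqr_ge0 // divr_ge0.
have lt2 : e * j.+2%:R ^+ 2 <= 2 * L * D ^+ 2.
  have h1 : a ^+ 2 * j.+2%:R ^+ 2 <= 4.
    rewrite -exprMn (_ : 4 = 2 ^+ 2); last by ring.
    by rewrite ler_sqr ?nnegrE // mulr_ge0 // ltW.
  have c0 : 0 <= L / 2 * D ^+ 2 by rewrite mulr_ge0 ?sqr_ge0 // divr_ge0.
  have := ler_wpM2l c0 h1.
  have := ler_wpM2r (sqr_ge0 (j.+2%:R : R)) (ltW lt1).
  by lra.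
have -> : D = Num.sqrt (D ^+ 2) by rewrite sqrtr_sqr ger0_norm.
rewrite -sqrtrM ?sqr_ge0 // -[leLHS]ger0_norm ?ler0n // -sqrtr_sqr ler_sqrt; last first.
  by rewrite mulr_ge0 ?sqr_ge0 // divr_ge0 ?(ltW e_gt0) // mulr_ge0.
rewrite mulrA ler_pdivlMr //.
have : (j.+1%:R : R) ^+ 2 <= j.+2%:R ^+ 2 by rewrite ler_sqr ?nnegrE // ler_nat.
by move/(ler_wpM2l (ltW e_gt0)); lra.
Qed.

(* The geometric mean of the two bounds [L D^2 / 4] at the first iterate and
   [(1 - s)^j L D^2] at the [j]-th one is [L D^2 / 2] times a decaying factor,
   which is why no additive constant appears next to the logarithm. *)
Lemma nesterov_stops_strong A : 0 < mu -> L * D ^+ 2 / (2 * e) <= A ->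
  exists T, stops_at target w T /\
            T%:R <= 1 + 2 * Num.sqrt (L / mu) * Num.max 0 (ln A).
Proof.
move=> mu0 LA; have L0 : 0 < L := lt_le_trans mu0 mu_le.
have M0 : 0 <= Num.max 0 (ln A) by rewrite le_max lexx.
apply: stops_of_bound; first by rewrite !mulr_ge0 ?sqrtr_ge0.
move=> [//|j] _ rj; have [u Su eu] := running_gap rj.
(* The witness for the first iterate may differ from [u]; both bounds involve only [D], so they can
   still be multiplied. *)
have [u1 Su1 eu1] := running_gap (running_lt rj (isT : (1 <= j.+1)%N)).
have [W [Wc SW Whw Wlip]] := w_smooth.
have rj' : running target w j by exact: running_lt rj (leqnSn j).
have h1 : e < L * D ^+ 2 / 4.
  apply: lt_le_trans eu1 _.
  have := w_prox rj' (isT : (0 < j.+1)%N); rewrite w_run.1 => p1.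
  have := prox_gap_quarter mu_ge0 phi_strong Wc Wlip (convex_edom h_convex X_convex)
     SW (fine_convex h_convex X_convex) p1 Sw0 Su1.
  move/le_trans; apply; rewrite mulrAC ler_wpM2r // ler_wpM2l ?diam2 //.
have al i := nesterov_alpha_strong i mu0 L0.
set s := Num.sqrt (mu / L) in al.
have s0 : 0 < s by rewrite sqrtr_gt0 divr_gt0.
have s2 : s ^+ 2 = mu / L by rewrite sqr_sqrtr // divr_ge0 ?ltW.
have s1 : s <= 1.
  by rewrite -ler_sqr ?nnegrE ?ler01 ?(ltW s0) // expr1n s2 ler_pdivrMr // mul1r.
have h2 : e < (1 - s) ^+ j.+1 * (L * D ^+ 2).
  apply: lt_le_trans eu _.
  have muE : mu = s ^+ 2 * L by rewrite s2 divfK ?gt_eqF.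
  have s01 : 0 < s <= 1 by rewrite s0.
  have := strong_rate mu_ge0 L_ge0 phi_strong Wc Wlip (convex_edom h_convex X_convex)
    SW (fine_convex h_convex X_convex) w_run.1 Sw0
    (fun i (ij : (i < j.+1)%N) => Whw i (running_lt rj' ij))
    (fun i ij => w_prox rj' ij) (fun i ij => w_hwS rj' ij) Su s01 muE al (ltnSn j).
  move/le_trans; apply; rewrite ler_wpM2l ?exprn_ge0 ?subr_ge0 // ler_wpM2l //.
  rewrite expr2 ler_pM ?enorm_ge0 ?S_diam //.
  by apply: w_in; exact: running_lt rj' (leq0n j).
set x := s * j.+1%:R.
have h3 : (1 - s) ^+ j.+1 <= expR (- x).
  rewrite /x -mulNr expRM_natr lerXn2r ?nnegrE ?subr_ge0 ?expR_ge0 //.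
  exact: expR_ge1Dx.
have C0 : 0 < L * D ^+ 2.
  by have := lt_trans e_gt0 h1; rewrite pmulr_lgt0 // invr_gt0.
have A0 : 0 < A by apply: lt_le_trans LA; rewrite divr_gt0 // mulr_gt0.
have LA' : L * D ^+ 2 <= A * (2 * e) by rewrite -ler_pdivrMr // mulr_gt0.
have h4 : e < expR (- x) * (L * D ^+ 2).
  by apply: lt_le_trans h2 _; rewrite ler_wpM2r // ltW.
have h5 : expR x < A ^+ 2.
  have E0 := expR_gt0 x.
  have h6 : e * expR x < L * D ^+ 2.
    move: h4; rewrite expRN mulrC ltr_pdivlMr //.
  (* Multiplying the two bounds on [e] and using [L * D ^+ 2 <= 2 * e * A] gives [expR x < A ^+ 2];
     the quarter from the first step cancels the square of 2. *)
  have h7 : (e * expR x) * e < L * D ^+ 2 * (L * D ^+ 2 / 4).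
    by apply: ltr_pM; rewrite // ?mulr_ge0 // ltW.
  have h8 : (L * D ^+ 2) * (L * D ^+ 2) <= (A * (2 * e)) * (A * (2 * e)).
    by apply: ler_pM => //; rewrite ltW.
  have : (e * e) * expR x < (e * e) * A ^+ 2 by lra.
  by rewrite ltr_pM2l // mulr_gt0.
have h9 : x < 2 * ln A.
  have -> : 2 * ln A = ln (A ^+ 2) by rewrite lnXn // mulr_natl.
  by rewrite -[ltLHS]expRK ltr_ln ?posrE ?expR_gt0 ?exprn_gt0.
have -> : Num.sqrt (L / mu) = s^-1 by rewrite -sqrtrV ?divr_ge0 ?ltW // invf_div.
rewrite mulrAC ler_pdivlMr // mulrC -/x.
apply: le_trans (ltW h9) _.
by rewrite ler_pM2l // le_max lexx orbT.
Qed.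

End NesterovComplexity.

(** * The augmented penalty *)

Section Penalty.
Context {R : realType}.
Implicit Types (beta u v : R).

(** Completing the square merges the two branches, and the positive part that appears is the updated
    multiplier. *)
Lemma penaltyE beta u v : 0 < beta ->
  penalty beta u v = (Num.max 0 (beta * u + v) ^+ 2 - v ^+ 2) / (2 * beta).
Proof.
move=> b0; rewrite /penalty; have bN0 := lt0r_neq0 b0.
by case: leP => _; field.
Qed.

(** [Num.max 0 (beta * u + v)] is the derivative in [u]; the two bounds express convexity and
    [beta]-smoothness. After scaling by [2 * beta] they concern only the squared positive part and
    split into four sign cases. *)
Lemma penalty_grad beta u v u' : 0 < beta ->
  0 <= penalty beta u' v - penalty beta u v - Num.max 0 (beta * u + v) * (u' - u)
    <= beta / 2 * (u' - u) ^+ 2.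
Proof.
move=> b0; rewrite !penaltyE //.
have [t tE] : exists t, t = beta * u + v by eexists.
have [t' t'E] : exists t', t' = beta * u' + v by eexists.
have dE : u' - u = (t' - t) / beta by rewrite t'E tE; field; rewrite lt0r_neq0.
rewrite -tE -t'E dE {dE tE t'E}.
have -> : (Num.max 0 t' ^+ 2 - v ^+ 2) / (2 * beta)
  - (Num.max 0 t ^+ 2 - v ^+ 2) / (2 * beta) - Num.max 0 t * ((t' - t) / beta)
  = (2 * beta)^-1 * (Num.max 0 t' ^+ 2 - Num.max 0 t ^+ 2
    - 2 * Num.max 0 t * (t' - t)) by field; rewrite lt0r_neq0.
have -> : beta / 2 * ((t' - t) / beta) ^+ 2 = (2 * beta)^-1 * (t' - t) ^+ 2.
  by field; rewrite lt0r_neq0.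
have c0 : 0 < (2 * beta)^-1 by rewrite invr_gt0 mulr_gt0.
rewrite pmulr_rge0 // ler_pM2l //.
have [ht|ht] := leP 0 t; have [ht'|ht'] := leP 0 t'; apply/andP; split.
- by have := sqr_ge0 (t' - t); lra.
- lra.
- by have := sqr_ge0 t; have := mulr_ge0_le0 ht (ltW ht'); lra.
- by have := sqr_ge0 t'; lra.
- by have := sqr_ge0 t'; lra.
- by have := sqr_ge0 t; have := mulr_ge0_le0 ht' (ltW ht); lra.
- lra.
- by have := sqr_ge0 (t' - t); lra.
Qed.

(** The sandwich in [penalty_grad] leaves a remainder of at most [beta / 2 * t ^+ 2], so the kink
    needs no separate treatment. *)
Lemma derivable_penalty beta u v : 0 < beta ->
  derivable (fun u => penalty beta u v) u 1.
Proof.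
move=> b0; apply/cvg_ex; exists (Num.max 0 (beta * u + v)).
apply/cvgrPdist_le => e e0; near=> t.
have tN0 : t != 0 by near: t; exact: nbhs_dnbhs_neq.
have te : `|t| <= e / beta.
  near: t; apply: dnbhs0_le; exact: divr_gt0.
rewrite /= scaler1 distrC.
have /andP[h1 h2] := penalty_grad u v (t + u) b0.
rewrite addrK in h1 h2.
set q := penalty _ _ _ - _ in h1 h2 *.
have -> : t^-1 *: q - Num.max 0 (beta * u + v) =
    t^-1 * (q - Num.max 0 (beta * u + v) * t) by rewrite mulrBr mulrCA mulVf ?mulr1.
rewrite normrM (ger0_norm h1) normfV ler_pdivrMl ?normr_gt0 //.
apply: le_trans h2 _; rewrite -real_normK ?num_real //.
move: te; rewrite ler_pdivlMr // => te.
have := normr_ge0 t; move: (`|t|) te => s te s0; nra.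
Unshelve. all: by end_near.
Qed.

Lemma penalty_le0 beta u v : 0 < beta -> 0 <= v -> u <= 0 -> penalty beta u v <= 0.
Proof.
move=> b0 v0 u0; rewrite penaltyE // ler_pdivrMr ?mul0r ?mulr_gt0 //.
have bu0 : beta * u <= 0 by rewrite pmulr_rle0.
rewrite subr_le0 ler_sqr ?nnegrE ?le_max ?lexx // ge_max v0 /=; lra.
Qed.

Section MultiplierStep.
Variables (beta u v v' : R).
Hypotheses (b0 : 0 < beta) (v'E : v' = v + beta * Num.max (- (v / beta)) u).

Lemma multiplier_max : v' = Num.max 0 (beta * u + v).
Proof.
rewrite v'E maxr_pMr ?ltW // mulrN mulrC divfK ?lt0r_neq0 // addrC.
by rewrite addr_maxl addNr.
Qed.

Lemma multiplier_ge0 : 0 <= v'.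
Proof. by rewrite multiplier_max le_max lexx. Qed.

Lemma penalty_multiplier : penalty beta u v = (v' ^+ 2 - v ^+ 2) / (2 * beta).
Proof. by rewrite penaltyE // multiplier_max. Qed.

Lemma multiplier_ge : beta * u <= v' - v.
Proof. by rewrite lerBrDr multiplier_max le_max lexx orbT. Qed.

End MultiplierStep.
End Penalty.

Section SmoothPart.
Context {R : realType} {n m : nat}.
Variables (g : 'rV[R]_n -> R) (f : 'I_m -> 'rV[R]_n -> R) (mu beta : R).
Hypothesis g_diff : forall x, differentiable g x.
Hypothesis g_strong : strongly_convex mu g.
Hypothesis f_convex : forall i, convex_differentiable (f i).
Hypothesis beta_gt0 : 0 < beta.
Implicit Types (x y : 'rV[R]_n) (z : 'rV[R]_m).

Lemma convex_functionP (F : 'rV[R]_n -> R) x y t : convex_function setT F ->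
  0 <= t <= 1 -> F (t *: x + (1 - t) *: y) <= t * F x + (1 - t) * F y.
Proof.
move=> Fc /andP[t0 t1].
by have := Fc (Itv01 t0 t1) x y; rewrite !inE => /(_ I I).
Qed.

Lemma convex_strongly (F : 'rV[R]_n -> R) :
  convex_function setT F -> strongly_convex 0 F.
Proof.
by move=> Fc x y t t01; rewrite !mul0r subr0; exact: convex_functionP.
Qed.

(** A convex nondecreasing function composed with a convex one: the supporting line at [w] has slope
    [c >= 0], so the convexity bound on [w] can be multiplied by [c]. *)
Lemma convex_penalty z i x y t : 0 <= t <= 1 ->
  penalty beta (f i (t *: x + (1 - t) *: y)) (z 0 i) <=
  t * penalty beta (f i x) (z 0 i) + (1 - t) * penalty beta (f i y) (z 0 i).
Proof.
move=> t01; have := convex_functionP x y (f_convex i).1 t01.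
have /andP[t0 t1] := t01; have s0 : 0 <= 1 - t by lra.
set w := f i _ => wle.
have /andP[h1 _] := penalty_grad w (z 0 i) (f i x) beta_gt0.
have /andP[h2 _] := penalty_grad w (z 0 i) (f i y) beta_gt0.
have : 0 <= Num.max 0 (beta * w + z 0 i) by rewrite le_max lexx.
move: (Num.max _ _) h1 h2 => c h1 h2 c0.
have := ler_wpM2l t0 h1; have := ler_wpM2l s0 h2; have := ler_wpM2l c0 wle.
by lra.
Qed.

Lemma smooth_part_strong z : strongly_convex mu (smooth_part g f beta z).
Proof.
move=> x y t t01; rewrite /smooth_part.
have := g_strong x y t01.
have : \sum_(i < m) penalty beta (f i (t *: x + (1 - t) *: y)) (z 0 i) <=
    t * \sum_(i < m) penalty beta (f i x) (z 0 i) +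
    (1 - t) * \sum_(i < m) penalty beta (f i y) (z 0 i).
  by rewrite !mulr_sumr -big_split; apply: ler_sum => i _; exact: convex_penalty.
by lra.
Qed.

Lemma smooth_part_differentiable z x : differentiable (smooth_part g f beta z) x.
Proof.
have -> : smooth_part g f beta z = g \+ \sum_(i < m)
    ((fun u => penalty beta u (z 0 i)) \o f i).
  by apply/funext => y /=; rewrite /smooth_part fct_sumE.
apply: differentiableD; first exact: g_diff.
apply: differentiable_sum => i; apply: differentiable_comp.
  exact: (f_convex i).2.
by apply/derivable1_diffP; exact: derivable_penalty.
Qed.

Lemma smooth_part_grad z x y :
  smooth_part g f beta z x + dot (grad (smooth_part g f beta z) x) (y - x)
  + mu / 2 * enorm (y - x) ^+ 2 <= smooth_part g f beta z y.
Proof.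
apply: grad_ineq; [exact: smooth_part_strong|exact: smooth_part_differentiable].
Qed.

End SmoothPart.

(** * Multiplier bounds *)

Section AugmentedLagrangianMethod.
Context {R : realType} {n m : nat}.
Variables (X : set 'rV[R]_n) (g : 'rV[R]_n -> R) (h : 'rV[R]_n -> \bar R).
Variables (f : 'I_m -> 'rV[R]_n -> R) (xs : 'rV[R]_n) (zs : 'rV[R]_m).
Hypothesis h_convex : convex_ext h.
Hypothesis f_convex : forall i, convex_differentiable (f i).
Hypothesis KKT : is_KKT g h f X xs zs.
Let S := edom h `&` X.
Let F0 x := g x + fine (h x).

Lemma objectiveE x : edom h x -> objective g h x = (F0 x)%:E.
Proof. by move=> /(edom_fin h_convex) hx; rewrite /objective hx. Qed.

Lemma KKT_dom : S xs.
Proof.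
have [[s [v [[fin_xs _] _ _]]] Xxs _] := KKT; split=> //.
move: fin_xs; rewrite /objective fin_numD => /andP[_].
by rewrite fin_numE => /andP[_]; rewrite -ltey.
Qed.

(** Saddle-point inequality: the gradient inequalities of the constraints at [xs] are weighted by
    [zs] and inserted into stationarity; complementary slackness removes the constraint values at
    [xs]. *)
Lemma KKT_lower x : S x -> F0 xs <= F0 x + \sum_(i < m) zs 0 i * f i x.
Proof.
move=> Sx; have [[s [v [[_ sub] [_ nv] sum0]]] _ comp] := KKT.
have := sub x; rewrite (objectiveE KKT_dom.1) (objectiveE Sx.1) -EFinD lee_fin.
have := nv x Sx.2.
have : 0 <= \sum_(i < m) zs 0 i * f i x
    - dot (\sum_(i < m) zs 0 i *: grad (f i) xs) (x - xs).
  have -> : dot (\sum_(i < m) zs 0 i *: grad (f i) xs) (x - xs) =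
      \sum_(i < m) zs 0 i * dot (grad (f i) xs) (x - xs).
    elim/big_ind2: _ => [|a b c d <- <-|i _]; first exact: dot0l.
      exact: dotDl.
    exact: dotZl.
  rewrite -sumrB; apply: sumr_ge0 => i _.
  have [z0 f0 zf0] := comp i.
  have := grad_ineq x (convex_strongly (f_convex i).1) ((f_convex i).2 xs).
  rewrite !mul0r addr0 => /(ler_wpM2l z0); rewrite mulrDr zf0 add0r => H.
  by rewrite subr_ge0.
have -> : \sum_(i < m) zs 0 i *: grad (f i) xs = - (s + v).
  by apply/eqP; rewrite -addr_eq0 addrC sum0.
by rewrite dotNl dotDl; lra.
Qed.

Section OneStep.
Variables (beta e : R) (z z' : 'rV[R]_m) (x' : 'rV[R]_n).
Hypothesis beta_gt0 : 0 < beta.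
Hypothesis z_ge0 : forall i, 0 <= z 0 i.
Hypothesis x'_sol : eps_solution X (aug_lagrangian g h f beta z) e x'.
Hypothesis z'E : forall i,
  z' 0 i = z 0 i + beta * Num.max (- (z 0 i / beta)) (f i x').

Lemma aug_lagrangianE v : edom h v ->
  aug_lagrangian g h f beta z v = (smooth_part g f beta z v + fine (h v))%:E.
Proof.
move=> hv; rewrite /aug_lagrangian objectiveE // -EFinD /smooth_part /F0.
by congr (_%:E); rewrite addrAC.
Qed.

Lemma aug_lagrangian_out v : ~ edom h v ->
  aug_lagrangian g h f beta z v = +oo%E.
Proof.
move=> /negP; rewrite -leNgt leye_eq => /eqP hv.
by rewrite /aug_lagrangian /objective hv addey // addye.
Qed.

Lemma aug_solutionP x : eps_solution X (aug_lagrangian g h f beta z) e x <->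
  S x /\ forall u, S u -> smooth_part g f beta z x + fine (h x) <=
                          smooth_part g f beta z u + fine (h u) + e.
Proof.
apply: (@eps_solutionP _ _ _ _ _ (fun v => smooth_part g f beta z v + fine (h v))).
- by move=> v [hv _]; exact: aug_lagrangianE.
- exact: aug_lagrangian_out.
- by exists xs; exact: KKT_dom.
Qed.

Lemma iALM_step_dom : S x'. Proof. by have /aug_solutionP[] := x'_sol. Qed.

(** [x'] is compared with [xs], where feasibility makes the penalty nonpositive; at [x'] the penalty
    is exactly the change of the squared multipliers. *)
Lemma iALM_step_upper :
  F0 x' + (dot z' z' - dot z z) / (2 * beta) <= F0 xs + e.
Proof.
have /aug_solutionP[_ /(_ _ KKT_dom)] := x'_sol.
rewrite /smooth_part /F0.
have -> : \sum_(i < m) penalty beta (f i x') (z 0 i) =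
    (dot z' z' - dot z z) / (2 * beta).
  rewrite /dot -sumrB mulr_suml; apply: eq_bigr => i _.
  by rewrite (penalty_multiplier beta_gt0 (z'E i)) !expr2.
have : \sum_(i < m) penalty beta (f i xs) (z 0 i) <= 0.
  apply: sumr_le0 => i _; have [_ _ /(_ i)[_ f0 _]] := KKT.
  exact: penalty_le0.
by lra.
Qed.

(** The update gives [beta * f i x' <= z' 0 i - z 0 i], which bounds the constraint term of
    [KKT_lower]. *)
Lemma iALM_step_lower : F0 xs - dot zs (z' - z) / beta <= F0 x'.
Proof.
have := KKT_lower iALM_step_dom.
suff : \sum_(i < m) zs 0 i * f i x' <= dot zs (z' - z) / beta by lra.
rewrite /dot mulr_suml; apply: ler_sum => i _; rewrite !mxE -mulrA.
apply: ler_wpM2l; first by have [_ _ /(_ i)[]] := KKT.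
by rewrite ler_pdivlMr // mulrC; exact: multiplier_ge beta_gt0 (z'E i).
Qed.

(** The upper and lower estimates are subtracted and multiplied by [2 * beta]; the inner product
    completes the squares around [zs]. *)
Lemma iALM_step_dist :
  dot (z' - zs) (z' - zs) <= dot (z - zs) (z - zs) + 2 * beta * e.
Proof.
have h1 := iALM_step_upper; have h2 := iALM_step_lower.
have : (dot z' z' - dot z z) / (2 * beta) - dot zs (z' - z) / beta <= e by lra.
have -> : (dot z' z' - dot z z) / (2 * beta) - dot zs (z' - z) / beta =
   (dot z' z' - dot z z - 2 * dot zs (z' - z)) / (2 * beta).
  by field; rewrite lt0r_neq0.
rewrite ler_pdivrMr ?mulr_gt0 // !dotE (dotC z' zs) (dotC z zs); lra.
Qed.

Lemma iALM_step_feasible :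
  enorm (\row_(i < m) Num.max (f i x') 0) <= enorm (z' - z) / beta.
Proof.
have -> : enorm (z' - z) / beta = enorm (beta^-1 *: (z' - z)).
  by rewrite enormZ gtr0_norm ?invr_gt0 // mulrC.
apply: ler_enorm => i; rewrite !mxE ger0_norm ?le_max ?lexx ?orbT //.
rewrite normrM gtr0_norm ?invr_gt0 // mulrC ler_pdivlMr // mulrC.
rewrite maxr_pMr ?(ltW beta_gt0) // mulr0 ge_max normr_ge0 andbT.
apply: le_trans (multiplier_ge beta_gt0 (z'E i)) (ler_norm _).
Qed.

End OneStep.

Section Iterates.
Variables (K : nat) (beta epsk : nat -> R) (Ce : R).
Variables (x : nat -> 'rV[R]_n) (z : nat -> 'rV[R]_m).
Hypothesis beta_gt0 : forall k, 0 < beta k.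
Hypothesis epsk_ge0 : forall k, (k < K)%N -> 0 <= epsk k.
Hypothesis Ce_ge0 : 0 <= Ce.
Hypothesis sum_eps : 2 * \sum_(k < K) beta k * epsk k <= Ce.
Hypothesis run : is_iALM g h f X K beta beta epsk x z.
Hypothesis z0 : z 0%N = 0.

Lemma iALM_multiplier_ge0 k i : (k <= K)%N -> 0 <= z k 0 i.
Proof.
elim: k => [|k IH] kK; first by rewrite z0 mxE.
have [_ zE] := run.2 k kK.
exact: multiplier_ge0 (beta_gt0 k) (zE i).
Qed.

Lemma iALM_dom k : (k <= K)%N -> S (x k).
Proof.
case: k => [_|k kK]; first exact: run.1.
exact: iALM_step_dom (run.2 k kK).1.
Qed.

(** The one-step estimates telescope from [z 0 = 0], and [enorm zs ^+ 2 + Ce] is at most the square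
    of the right-hand side. *)
Lemma iALM_dist k : (k <= K)%N -> enorm (z k - zs) <= enorm zs + Num.sqrt Ce.
Proof.
move=> kK.
have h1 : dot (z k - zs) (z k - zs) <=
    dot zs zs + 2 * \sum_(t < k) beta t * epsk t.
  elim: k kK => [|k IH] kK.
    by rewrite z0 sub0r !dotE opprK big_ord0 mulr0 addr0.
  have zk0 i : 0 <= z k 0 i by apply: iALM_multiplier_ge0; exact: ltnW.
  have [xsol zE] := run.2 k kK.
  have := iALM_step_dist (beta_gt0 k) zk0 xsol zE.
  by have := IH (ltnW kK); rewrite big_ord_recr /=; lra.
have h2 : \sum_(t < k) beta t * epsk t <= \sum_(t < K) beta t * epsk t.
  rewrite -!(big_mkord xpredT (fun t => beta t * epsk t)).
  rewrite [leRHS](big_cat_nat (n := k)) //= lerDl big_nat; apply: sumr_ge0 => t.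
  by move=> /andP[_ tK]; rewrite mulr_ge0 ?epsk_ge0 // ltW.
rewrite -ler_sqr ?nnegrE ?addr_ge0 ?enorm_ge0 ?sqrtr_ge0 //.
rewrite sqr_enorm sqrrD sqr_enorm sqr_sqrtr //.
have h3 := le_trans (ler_wpM2l (ler0n R 2) h2) sum_eps.
apply: le_trans h1 _; rewrite -addrA lerD2l; apply: le_trans h3 _.
by rewrite lerDr mulrn_wge0 // mulr_ge0 ?enorm_ge0 ?sqrtr_ge0.
Qed.

Lemma iALM_multiplier k : (k <= K)%N -> enorm (z k) <= 2 * enorm zs + Num.sqrt Ce.
Proof.
move=> kK; have := iALM_dist kK; have := enormD (z k - zs) zs.
by rewrite subrK; lra.
Qed.

Variables (b C : R).
Hypotheses (b_gt0 : 0 < b) (K_gt0 : (0 < K)%N).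
Hypothesis beta_last : b^-1 <= beta K.-1.
Hypothesis eps_last : epsk K.-1 <= C.

(** The last violation is at most the last multiplier increment over the last penalty; the increment
    is bounded through [zs] by twice the bound of [iALM_dist]. *)
Lemma iALM_feasible :
  enorm (\row_(i < m) Num.max (f i (x K)) 0) <=
  b * (2 * enorm zs + 2 * Num.sqrt Ce).
Proof.
have kK : (K.-1 < K)%N by rewrite prednK.
have [xsol zE] := run.2 _ kK; rewrite prednK // in xsol zE.
apply: le_trans (iALM_step_feasible (beta_gt0 _) zE) _.
rewrite mulrC; apply: ler_pM; rewrite ?invr_ge0 ?enorm_ge0 ?(ltW (beta_gt0 _)) //.
  by rewrite -[leRHS]invrK lef_pV2 ?posrE ?invr_gt0.
have := iALM_dist (leqnn K); have := iALM_dist (leq_pred K).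
have := enorm_sub_sym (z K) zs (z K.-1).
by rewrite (enormB zs); lra.
Qed.

(** The lower side combines [KKT_lower], Cauchy-Schwarz and the feasibility bound; the upper side
    keeps only the squared norm of the previous multiplier from [iALM_step_upper]. *)
Lemma iALM_objective :
  `|F0 (x K) - F0 xs| <= C + b * (2 * enorm zs + Num.sqrt Ce)
    * (5 * enorm zs + 7 / 2 * Num.sqrt Ce).
Proof.
have kK : (K.-1 < K)%N by rewrite prednK.
have [xsol zE] := run.2 _ kK; rewrite prednK // in xsol zE.
have z'0 i : 0 <= z K.-1 0 i by apply: iALM_multiplier_ge0; exact: ltnW.
have up := iALM_step_upper (beta_gt0 _) z'0 xsol zE.
have lo := KKT_lower (iALM_dom (leqnn K)).
have fe := iALM_feasible.
have e0 := enorm_ge0 zs; have c0 := sqrtr_ge0 Ce.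
have hlo : \sum_(i < m) zs 0 i * f i (x K) <=
    enorm zs * (b * (2 * enorm zs + 2 * Num.sqrt Ce)).
  apply: (@le_trans _ _ (dot zs (\row_(i < m) Num.max (f i (x K)) 0))).
    apply: ler_sum => i _; rewrite mxE ler_wpM2l //.
      by have [_ _ /(_ i)[]] := KKT.
    by rewrite le_max lexx.
  apply: le_trans (cauchy_schwarz _ _) _.
  by rewrite ler_wpM2l.
have hup : - (dot (z K) (z K) - dot (z K.-1) (z K.-1)) / (2 * beta K.-1) <=
    b / 2 * (2 * enorm zs + Num.sqrt Ce) ^+ 2.
  have zb := iALM_multiplier (leq_pred K).
  have h1 : - (dot (z K) (z K) - dot (z K.-1) (z K.-1)) <=
      (2 * enorm zs + Num.sqrt Ce) ^+ 2.
    have : enorm (z K.-1) ^+ 2 <= (2 * enorm zs + Num.sqrt Ce) ^+ 2.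
      by rewrite ler_sqr ?nnegrE ?enorm_ge0 // addr_ge0 // mulr_ge0.
    by rewrite sqr_enorm; have := dot_ge0 (z K); lra.
  rewrite ler_pdivrMr ?mulr_gt0 //; apply: le_trans h1 _.
  have : 1 <= b * beta K.-1 by rewrite mulrC -ler_pdivrMr // div1r.
  have := sqr_ge0 (2 * enorm zs + Num.sqrt Ce).
  move: (_ ^+ 2) => q q0 /(ler_wpM2l q0).
  by lra.
(* The monomials that separate the derived constants from the stated ones, supplied so that the
   remaining comparison is linear. *)
have bc : 0 <= b * (enorm zs * Num.sqrt Ce) by rewrite !mulr_ge0 // ltW.
have bcc : 0 <= b * (Num.sqrt Ce * Num.sqrt Ce) by rewrite !mulr_ge0 // ltW.
have bee : 0 <= b * (enorm zs * enorm zs) by rewrite !mulr_ge0 // ltW.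
have C0 : 0 <= C by apply: le_trans eps_last; exact: epsk_ge0.
move: hup; rewrite mulNr => hup; have epsC := eps_last.
by rewrite ler_norml; apply/andP; split; lra.
Qed.

End Iterates.
End AugmentedLagrangianMethod.

(** * Geometrically increasing penalties *)

Section RealLemmas.
Context {R : realType}.
Implicit Types (a b c q : R).

Lemma geometric_sum c q K : q != 1 ->
  \sum_(k < K) c * q ^+ k = c * (q ^+ K - 1) / (q - 1).
Proof.
by move=> q1; rewrite -mulr_sumr subrX1 mulrA mulrAC mulfK // subr_eq0.
Qed.

Lemma sqrt_div a b : 0 <= a -> 0 <= b -> Num.sqrt (a / b) = Num.sqrt a / Num.sqrt b.
Proof. by move=> a0 b0; rewrite sqrtrM // sqrtrV. Qed.

Lemma sqrt_subadditive a b : 0 <= a -> 0 <= b ->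
  Num.sqrt (a + b) <= Num.sqrt a + Num.sqrt b.
Proof.
move=> a0 b0; rewrite -ler_sqr ?nnegrE ?addr_ge0 ?sqrtr_ge0 // sqrrD.
rewrite !sqr_sqrtr ?addr_ge0 // addrAC lerDl mulrn_wge0 //.
Qed.

Lemma le_sqr_sqrt a b : 0 <= a -> a ^+ 2 <= b -> a <= Num.sqrt b.
Proof.
by move=> a0 ab; rewrite -(ger0_norm a0) -sqrtr_sqr ler_wsqrtr.
Qed.

Lemma sqrt_expn a k : 0 <= a -> Num.sqrt (a ^+ k) = Num.sqrt a ^+ k.
Proof.
by move=> a0; elim: k => [|k IH]; rewrite ?sqrtr1 // !exprS sqrtrM // IH.
Qed.

Lemma sqrt_even a k : 0 <= a -> Num.sqrt (a ^+ (2 * k)) = a ^+ k.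
Proof.
move=> a0; rewrite mulnC exprM sqrtr_sqr ger0_norm // exprn_ge0 //.
Qed.

Lemma powR_expn a q (i j : nat) : 0 <= a -> i%:R * q = j%:R ->
  (a ^+ i) `^ q = a ^+ j.
Proof. by move=> a0 ijq; rewrite -powR_mulrn // -powRrM ijq powR_mulrn. Qed.

End RealLemmas.

Section GeometricPenalties.
Context {R : realType}.
Variables (eps Cb Ce sigma : R) (K : nat).
Hypotheses (eps_gt0 : 0 < eps) (K_gt0 : (0 < K)%N).
Hypotheses (Cb_gt0 : 0 < Cb) (Ce_gt0 : 0 < Ce) (sigma_gt1 : 1 < sigma).
Let betag := Cb / eps * ((sigma - 1) / (sigma ^+ K - 1)).
Let beta k : R := betag * sigma ^+ k.

Let sigma_gt0 : 0 < sigma. Proof. exact: lt_trans sigma_gt1. Qed.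
Let sigmaB_gt0 : 0 < sigma - 1. Proof. by rewrite subr_gt0. Qed.

Let sigmaK_gt0 : 0 < sigma ^+ K - 1.
Proof. by rewrite subr_gt0 exprn_egt1 // -lt0n. Qed.

Lemma betag_gt0 : 0 < betag.
Proof. by rewrite mulr_gt0 // divr_gt0. Qed.

Lemma beta_gt0 k : 0 < beta k.
Proof. by rewrite mulr_gt0 ?betag_gt0 // exprn_gt0. Qed.

Lemma betag_total : betag * (sigma ^+ K - 1) = Cb * (sigma - 1) / eps.
Proof.
by rewrite /betag; field; rewrite !lt0r_neq0.
Qed.

Lemma sum_beta : \sum_(k < K) beta k = Cb / eps.
Proof.
rewrite geometric_sum ?gt_eqF // betag_total.
by field; rewrite !lt0r_neq0.
Qed.

(** Multiplied by [H], this closed form is the last summand inside the second logarithm of the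
    strongly convex bounds. *)
Lemma beta_last : beta K.-1 = (Cb * (sigma - 1) + betag * eps) / (sigma * eps).
Proof.
have : beta K.-1 * sigma = betag * (sigma ^+ K - 1) + betag.
  by rewrite /beta -mulrA -exprSr prednK // mulrBr mulr1 subrK.
rewrite betag_total => h; rewrite -[LHS](mulfK (lt0r_neq0 sigma_gt0)) h.
by field; rewrite !lt0r_neq0.
Qed.

Lemma beta_le k : (k < K)%N -> beta k <= beta K.-1.
Proof.
move=> kK; rewrite ler_pM2l ?betag_gt0 // ler_weXn2l //; first exact: ltW.
by rewrite -ltnS prednK.
Qed.

Lemma beta_last_ge : (eps * sigma / (Cb * (sigma - 1)))^-1 <= beta K.-1.
Proof.
rewrite beta_last invf_div (mulrC eps) ler_pM2r ?invr_gt0 ?mulr_gt0 //.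
by rewrite lerDl mulr_ge0 // ltW // betag_gt0.
Qed.

Let rho := Num.sqrt sigma.
Let rho_gt0 : 0 < rho. Proof. by rewrite sqrtr_gt0. Qed.
Let rho2 : rho ^+ 2 = sigma. Proof. by rewrite sqr_sqrtr // ltW. Qed.
Let rho_gt1 : 1 < rho.
Proof. by rewrite -(@ltr_pXn2r _ 2) ?nnegrE ?ler01 ?(ltW rho_gt0) // expr1n rho2. Qed.

(** A geometric sum of ratio [rho], simplified by [(y - 1) ^+ 2 <= y ^+ 2 - 1] for
    [y = rho ^+ K >= 1]. *)
Lemma sum_sqrt_beta : \sum_(k < K) Num.sqrt (beta k) <=
  Num.sqrt (Cb * (sigma - 1) / eps) / (rho - 1).
Proof.
have -> : \sum_(k < K) Num.sqrt (beta k) =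
    \sum_(k < K) Num.sqrt betag * rho ^+ k.
  apply: eq_bigr => k _; rewrite sqrtrM ?ltW ?betag_gt0 //.
  by rewrite sqrt_expn // ltW.
rewrite geometric_sum ?gt_eqF // ler_wpM2r ?invr_ge0 ?subr_ge0 ?(ltW rho_gt1) //.
have y1 : 1 <= rho ^+ K by rewrite exprn_ege1 // ltW.
apply: le_sqr_sqrt; first by rewrite mulr_ge0 ?sqrtr_ge0 // subr_ge0.
rewrite -betag_total exprMn sqr_sqrtr ?(ltW betag_gt0) //.
rewrite ler_pM2l ?betag_gt0 // -rho2 -exprM mulnC exprM.
by move: (rho ^+ K) y1 => y y1; nra.
Qed.

(** Source of the extra logarithm for the varying tolerances; [sigma - rho] arises as
    [rho * (rho - 1)]. *)
Lemma last_sqrt_beta : Num.sqrt (beta K.-1) * \sum_(t < K) Num.sqrt (beta t) <=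
  Cb / eps * (Num.sqrt ((sigma - 1) ^+ 2 + betag * eps * (sigma - 1) / Cb)
              / (sigma - rho)).
Proof.
apply: le_trans (ler_wpM2l (sqrtr_ge0 _) sum_sqrt_beta) _.
rewrite mulrA -sqrtrM ?(ltW (beta_gt0 _)) // beta_last.
have Y0 : 0 <= (sigma - 1) ^+ 2 + betag * eps * (sigma - 1) / Cb.
  rewrite addr_ge0 ?sqr_ge0 // divr_ge0 ?(ltW Cb_gt0) //.
  by rewrite mulr_ge0 ?(ltW sigmaB_gt0) // mulr_ge0 ?(ltW betag_gt0) ?(ltW eps_gt0).
set Y := _ + _ in Y0 *.
have -> : (Cb * (sigma - 1) + betag * eps) / (sigma * eps) *
    (Cb * (sigma - 1) / eps) = (Cb / eps) ^+ 2 * Y / rho ^+ 2.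
  by rewrite rho2 /Y; field; rewrite !lt0r_neq0.
have c0 : 0 <= Cb / eps by rewrite divr_ge0 // ltW.
have cY0 : 0 <= (Cb / eps) ^+ 2 * Y by apply: mulr_ge0 => //; exact: sqr_ge0.
rewrite (sqrt_div cY0 (sqr_ge0 _)) (sqrtrM _ (sqr_ge0 _)) !sqrtr_sqr.
rewrite !ger0_norm ?(ltW rho_gt0) //.
rewrite le_eqVlt; apply/orP; left; apply/eqP.
rewrite -[X in X - rho]rho2; field.
rewrite !lt0r_neq0 ?subr_gt0 //.
by rewrite -[ltLHS]mulr1 expr2 ltr_pM2l.
Qed.

(** Subadditivity of the square root separates the constant part [Ls] from the growing part
    [beta k * H]. The factor [c] will be [eps^-1] or [mu^-1]. *)
Lemma sum_sqrt_lipschitz (Lk : nat -> R) (Ls H c : R) :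
  0 <= Ls -> 0 <= H -> 0 <= c -> (forall k, (k < K)%N -> Lk k <= Ls + beta k * H) ->
  \sum_(k < K) Num.sqrt (Lk k * c) <= K%:R * Num.sqrt (Ls * c)
    + Num.sqrt (H * c) * (Num.sqrt (Cb * (sigma - 1) / eps) / (rho - 1)).
Proof.
move=> Ls0 H0 c0 LkE.
apply: le_trans (lerD (lexx _) (ler_wpM2l (sqrtr_ge0 _) sum_sqrt_beta)).
rewrite mulr_sumr -[K in K%:R]card_ord -sum1_card natr_sum mulr_suml -big_split.
apply: ler_sum => k _ /=; rewrite mul1r -sqrtrM ?mulr_ge0 //.
apply: le_trans (sqrt_subadditive (mulr_ge0 Ls0 c0) _); last first.
  by apply: mulr_ge0; [exact: mulr_ge0|exact: ltW (beta_gt0 k)].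
apply: ler_wsqrtr; have -> : Ls * c + H * c * beta k = (Ls + beta k * H) * c by ring.
by rewrite ler_wpM2r // LkE.
Qed.

Section SixthRoots.
(** With sixth roots, the powers 1/3, 1/2 and 2/3 of [beta k] become the integer powers 2, 3 and 4
    of [a_ k]. *)
Let p := betag `^ (1 / 6).
Let r := sigma `^ (1 / 6).

Let p_gt0 : 0 < p. Proof. by rewrite powR_gt0 // betag_gt0. Qed.
Let r_gt0 : 0 < r. Proof. by rewrite powR_gt0. Qed.

Let root6 (a : R) : 0 <= a -> (a `^ (1 / 6)) ^+ 6 = a.
Proof.
move=> a0; rewrite -powR_mulrn ?powR_ge0 // -powRrM.
by rewrite (_ : 1 / 6 * 6%:R = 1) ?powRr1 //; lra.
Qed.

Let betaE k : beta k = (p * r ^+ k) ^+ 6.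
Proof.
by rewrite exprMn -exprM mulnC exprM !root6 // ltW // betag_gt0.
Qed.

Let a_ k := p * r ^+ k.
Let a_gt0 k : 0 < a_ k. Proof. by rewrite mulr_gt0 // exprn_gt0. Qed.

Let r_gt1 : 1 < r.
Proof.
by rewrite -(@ltr_pXn2r _ 6) ?nnegrE ?ler01 ?(ltW r_gt0) // expr1n root6 // ltW.
Qed.

Let r4_gt1 : 1 < r ^+ 4. Proof. by rewrite exprn_egt1. Qed.

(** After subadditivity of the root, only geometric sums of [a_ k] and [a_ k ^+ 4] remain. With
    [y = r ^+ K] the claim reduces to [(y ^+ 4 - 1) * (y - 1) ^+ 2 <= y ^+ 6 - 1] and
    [(y ^+ 4 - 1) ^+ 3 <= (y ^+ 6 - 1) ^+ 2]. *)
Lemma sum_sixth_roots (Lk : nat -> R) (Ls H : R) :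
  0 <= Ls -> 0 <= H -> (forall k, (k < K)%N -> Lk k <= Ls + beta k * H) ->
  \sum_(k < K) Num.sqrt (Lk k * (beta k `^ (1 / 3) * \sum_(t < K) beta t `^ (2 / 3)))
  <= Num.sqrt Ls * (Num.sqrt (Cb * (sigma - 1) / eps)
       / ((r - 1) * Num.sqrt (sigma `^ (2 / 3) - 1)))
   + Num.sqrt H * (Cb * (sigma - 1) / eps / (sigma `^ (2 / 3) - 1) `^ (3 / 2)).
Proof.
move=> Ls0 H0 LkE.
have b13 k : beta k `^ (1 / 3) = a_ k ^+ 2.
  by rewrite betaE (@powR_expn _ _ _ 6 2) ?(ltW (a_gt0 k)) //; lra.
have b23 k : beta k `^ (2 / 3) = a_ k ^+ 4.
  by rewrite betaE (@powR_expn _ _ _ 6 4) ?(ltW (a_gt0 k)) //; lra.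
have s23 : sigma `^ (2 / 3) = r ^+ 4.
  by rewrite -[sigma in LHS]root6 ?(ltW sigma_gt0) // (@powR_expn _ _ _ 6 4) ?(ltW r_gt0) //; lra.
have s32 : (r ^+ 4 - 1) `^ (3 / 2) = (r ^+ 4 - 1) * Num.sqrt (r ^+ 4 - 1).
  have c0 : 0 <= r ^+ 4 - 1 by rewrite subr_ge0 ltW.
  rewrite -{1}(sqr_sqrtr c0) (@powR_expn _ _ _ 2 3) ?sqrtr_ge0 //; last by lra.
  by rewrite exprSr sqr_sqrtr.
rewrite s23 s32.
under eq_bigr => k _ do rewrite b13.
under [\sum_(t < K) beta t `^ (2 / 3)]eq_bigr => t _ do rewrite b23.
set T4 := \sum_(t < K) a_ t ^+ 4.
have T40 : 0 <= T4 by apply: sumr_ge0 => t _; rewrite exprn_ge0 // (ltW (a_gt0 t)).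
apply: (@le_trans _ _ (Num.sqrt Ls * (Num.sqrt T4 * \sum_(k < K) a_ k)
   + Num.sqrt H * (Num.sqrt T4 * T4))).
  rewrite {3}/T4 !mulr_sumr -big_split; apply: ler_sum => k _ /=.
  have bH : 0 <= beta k * H by apply: mulr_ge0 => //; exact: ltW (beta_gt0 k).
  have -> : Num.sqrt Ls * (Num.sqrt T4 * a_ k) = Num.sqrt (Ls * (a_ k ^+ 2 * T4)).
    by rewrite (sqrtrM _ Ls0) (sqrtrM _ (sqr_ge0 _)) sqrtr_sqr gtr0_norm //; ring.
  have -> : Num.sqrt H * (Num.sqrt T4 * a_ k ^+ 4) =
      Num.sqrt (beta k * H * (a_ k ^+ 2 * T4)).
    rewrite (sqrtrM _ bH) (sqrtrM _ (ltW (beta_gt0 k))) (sqrtrM _ (sqr_ge0 _)).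
    by rewrite betaE (@sqrt_even _ _ 3) ?(ltW (a_gt0 k)) // -/(a_ k) sqrtr_sqr gtr0_norm //; ring.
  have q0 : 0 <= a_ k ^+ 2 * T4 by rewrite mulr_ge0 ?sqr_ge0.
  apply: le_trans (sqrt_subadditive (mulr_ge0 Ls0 q0) (mulr_ge0 bH q0)).
  by apply: ler_wsqrtr; rewrite -mulrDl ler_wpM2r // LkE.
have y1 : 1 <= r ^+ K by rewrite exprn_ege1 // ltW.
have Z : p ^+ 6 * ((r ^+ K) ^+ 6 - 1) = Cb * (sigma - 1) / eps.
  rewrite -betag_total /p root6 ?(ltW betag_gt0) // -exprM mulnC exprM.
  by rewrite /r root6 // ltW.
have T4E : T4 = p ^+ 4 * ((r ^+ K) ^+ 4 - 1) / (r ^+ 4 - 1).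
  rewrite -exprM mulnC exprM -geometric_sum ?gt_eqF //.
  by apply: eq_bigr => k _; rewrite exprMn -!exprM mulnC.
have T1E : \sum_(k < K) a_ k = p * (r ^+ K - 1) / (r - 1).
  by rewrite geometric_sum ?gt_eqF.
have r40 : 0 < r ^+ 4 - 1 by rewrite subr_gt0.
have r10 : 0 < r - 1 by rewrite subr_gt0.
rewrite -Z T1E.
have v0 : 0 < Num.sqrt (r ^+ 4 - 1) by rewrite sqrtr_gt0.
have v2 := sqr_sqrtr (ltW r40).
move: (Num.sqrt (r ^+ 4 - 1)) v0 v2 => v v0 v2; rewrite -v2 in T4E *.
move: (r ^+ K) y1 T4E => y y1 T4E.
have hT : T4 * v ^+ 2 = p ^+ 4 * (y ^+ 4 - 1).
  by rewrite T4E; field; rewrite lt0r_neq0.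
have sT := sqr_sqrtr T40; have sT0 := sqrtr_ge0 T4.
have y40 : 0 <= y ^+ 4 - 1 by rewrite subr_ge0 exprn_ege1.
have y60 : 0 <= y ^+ 6 - 1 by rewrite subr_ge0 exprn_ege1.
have p60 : 0 <= p ^+ 6 by rewrite exprn_ge0 // ltW.
apply: lerD; apply: ler_wpM2l; rewrite ?sqrtr_ge0 //.
  have -> : Num.sqrt T4 * (p * (y - 1) / (r - 1)) =
      Num.sqrt T4 * v * (p * (y - 1)) / ((r - 1) * v).
    by field; rewrite !lt0r_neq0.
  rewrite ler_wpM2r // ?invr_ge0 ?mulr_ge0 ?(ltW r10) ?(ltW v0) //.
  apply: le_sqr_sqrt.
    by rewrite !mulr_ge0 ?(ltW v0) ?(ltW p_gt0) // subr_ge0.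
  have -> : (Num.sqrt T4 * v * (p * (y - 1))) ^+ 2 =
      p ^+ 6 * ((y ^+ 4 - 1) * (y - 1) ^+ 2).
    rewrite 2!exprMn sT hT; ring.
  apply: ler_wpM2l => //.
  have : (y - 1) ^+ 2 <= y ^+ 2 - 1 by nra.
  move/(ler_wpM2l y40)/le_trans; apply.
  have y2 : 1 <= y ^+ 2 by rewrite exprn_ege1.
  have y4 : 1 <= y ^+ 4 by rewrite exprn_ege1.
  rewrite -subr_ge0; have -> : y ^+ 6 - 1 - (y ^+ 4 - 1) * (y ^+ 2 - 1) =
     y ^+ 4 - 1 + (y ^+ 2 - 1) by ring.
  by rewrite addr_ge0 // subr_ge0.
rewrite ler_pdivlMr ?mulr_gt0 ?exprn_gt0 //.
rewrite -ler_sqr ?nnegrE ?mulr_ge0 ?sqr_ge0 ?(ltW v0) ?(ltW p_gt0) //.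
have -> : (Num.sqrt T4 * T4 * (v ^+ 2 * v)) ^+ 2 =
    Num.sqrt T4 ^+ 2 * (T4 * v ^+ 2) ^+ 2 * v ^+ 2 by ring.
rewrite sT mulrAC hT.
have -> : p ^+ 4 * (y ^+ 4 - 1) * (p ^+ 4 * (y ^+ 4 - 1)) ^+ 2 =
    (p ^+ 6) ^+ 2 * (y ^+ 4 - 1) ^+ 3 by ring.
rewrite [leRHS]exprMn ler_wpM2l ?sqr_ge0 //.
have w1 : 1 <= y ^+ 2 by rewrite exprn_ege1.
(* As a polynomial in [y ^+ 2] the difference has the root 1; the cofactor is nonnegative from 1
   on. *)
rewrite -subr_ge0.
have -> : (y ^+ 6 - 1) ^+ 2 - (y ^+ 4 - 1) ^+ 3 = (y ^+ 2 - 1)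
    * (3 * (y ^+ 2) ^+ 3 + (y ^+ 2) ^+ 2 - 2 * y ^+ 2 - 2) by ring.
by move: (y ^+ 2) w1 => u u1; rewrite mulr_ge0 ?subr_ge0 //; nra.
Qed.

End SixthRoots.
End GeometricPenalties.

(** * Iteration totals *)

Section Totals.
Context {R : realType}.
Variables (eps Cb Ce sigma : R) (K : nat).
Hypotheses (eps_gt0 : 0 < eps) (K_gt0 : (0 < K)%N).
Hypotheses (Cb_gt0 : 0 < Cb) (Ce_gt0 : 0 < Ce) (sigma_gt1 : 1 < sigma).
Let betag := Cb / eps * ((sigma - 1) / (sigma ^+ K - 1)).
Let beta k : R := betag * sigma ^+ k.
Let b_gt0 k : 0 < beta k := beta_gt0 eps_gt0 K_gt0 Cb_gt0 sigma_gt1 k.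

Section Tolerances.
Variables (a c : nat -> R) (e : nat -> R).
Hypothesis a_gt0 : forall k, 0 < a k.
Hypothesis acE : forall k, a k * c k = beta k.
Hypothesis a_le : forall k, (k < K)%N -> a k <= a K.-1.
Hypothesis eE : forall k, (k < K)%N -> e k = Ce / 2 / (a k * \sum_(t < K) c t).

Let c_gt0 k : 0 < c k.
Proof. by rewrite -(pmulr_rgt0 _ (a_gt0 k)) acE. Qed.

Let sum_c_gt0 : 0 < \sum_(t < K) c t.
Proof.
rewrite lt_neqAle sumr_ge0 ?andbT => [|t _]; last exact: ltW.
rewrite eq_sym psumr_neq0 => [|t _]; last exact: ltW.
by apply/hasP; exists (Ordinal K_gt0); rewrite ?mem_index_enum //= c_gt0.
Qed.

Lemma split_tolerance_gt0 k : (k < K)%N -> 0 < e k.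
Proof. by move=> kK; rewrite eE // !divr_gt0 // mulr_gt0. Qed.

(** Covers both varying rules, with exponents 1/3 and 2/3 or 1/2 and 1/2 for [a] and [c]. Since
    [beta k * e k] is proportional to [c k], the budget [Ce] is spent exactly. *)
Lemma split_tolerance_sum : 2 * \sum_(k < K) beta k * e k <= Ce.
Proof.
have -> : \sum_(k < K) beta k * e k =
    Ce / 2 / (\sum_(t < K) c t) * \sum_(k < K) c k.
  rewrite mulr_sumr; apply: eq_bigr => k _; rewrite eE // -acE.
  by field; rewrite !lt0r_neq0.
by rewrite divfK ?lt0r_neq0 // mulrC divfK.
Qed.

(** As [a] is largest at the last index, [a K.-1] times the sum of [c] dominates the sum of all
    penalties, which is [Cb / eps]. *)
Lemma split_tolerance_last : e K.-1 <= eps / 2 * (Ce / Cb).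
Proof.
rewrite eE ?prednK // ler_pdivrMr; last by rewrite mulr_gt0.
have h : Cb / eps <= a K.-1 * \sum_(t < K) c t.
  rewrite -(sum_beta Cb eps_gt0 K_gt0 sigma_gt1) mulr_sumr.
  by apply: ler_sum => k _; rewrite -/(beta k) -acE ler_wpM2r ?(ltW (c_gt0 _)) ?a_le.
have c0 : 0 <= eps / 2 * (Ce / Cb) by rewrite !mulr_ge0 ?invr_ge0 ?(ltW eps_gt0) ?(ltW Ce_gt0) ?(ltW Cb_gt0).
apply: le_trans (ler_wpM2l c0 h).
by rewrite le_eqVlt; apply/orP; left; apply/eqP; field; rewrite !lt0r_neq0.
Qed.

End Tolerances.

Lemma const_tolerance_sum e :
  (forall k, (k < K)%N -> e k = eps / 2 * (Ce / Cb)) ->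
  2 * \sum_(k < K) beta k * e k <= Ce.
Proof.
move=> eE; have -> : \sum_(k < K) beta k * e k =
    \sum_(k < K) beta k * (eps / 2 * (Ce / Cb)).
  by apply: eq_bigr => k _; rewrite eE.
rewrite -mulr_suml (sum_beta Cb eps_gt0 K_gt0 sigma_gt1).
by rewrite le_eqVlt; apply/orP; left; apply/eqP; field; rewrite !lt0r_neq0.
Qed.

Variables (Lk : nat -> R) (Ls H : R) (T : nat -> nat).
Hypotheses (Ls_ge0 : 0 <= Ls) (H_ge0 : 0 <= H).
Hypothesis Lk_le : forall k, (k < K)%N -> Lk k <= Ls + beta k * H.
Hypothesis Lk_ge0 : forall k, (k < K)%N -> 0 <= Lk k.
Variable D : R.
Hypothesis D_ge0 : 0 <= D.

Lemma sum_one_plus (M : nat -> R) : (forall k, (k < K)%N -> (T k)%:R <= 1 + M k) ->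
  \sum_(k < K) (T k)%:R <= \sum_(k < K) M k + K%:R.
Proof.
move=> TM; rewrite -[X in X%:R]card_ord -sum1_card natr_sum -big_split /=.
by apply: ler_sum => k _; rewrite addrC TM.
Qed.

Lemma total_const_convex :
  (forall k, (k < K)%N ->
    (T k)%:R <= 1 + D * Num.sqrt (2 * Lk k / (eps / 2 * (Ce / Cb)))) ->
  \sum_(k < K) (T k)%:R <= 2 * D * Num.sqrt (Cb / Ce)
    * (K%:R * Num.sqrt (Ls / eps)
       + Num.sqrt (Cb * H * (sigma - 1)) / (eps * (Num.sqrt sigma - 1))) + K%:R.
Proof.
move=> /sum_one_plus/le_trans; apply; rewrite lerD2r.
have c0 : 0 <= Cb / Ce by rewrite divr_ge0 // ltW.
have -> : \sum_(k < K) D * Num.sqrt (2 * Lk k / (eps / 2 * (Ce / Cb))) =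
    2 * D * Num.sqrt (Cb / Ce) * \sum_(k < K) Num.sqrt (Lk k * eps^-1).
  rewrite mulr_sumr; apply: eq_bigr => k _.
  have -> : 2 * Lk k / (eps / 2 * (Ce / Cb)) = 2 ^+ 2 * ((Cb / Ce) * (Lk k * eps^-1)).
    by field; rewrite !lt0r_neq0.
  rewrite (sqrtrM _ (sqr_ge0 _)) (sqrtrM _ c0) sqrtr_sqr ger0_norm //; ring.
apply: ler_wpM2l; first by rewrite !mulr_ge0 // sqrtr_ge0.
have ei0 : 0 <= eps^-1 by rewrite invr_ge0 ltW.
apply: le_trans (sum_sqrt_lipschitz eps_gt0 K_gt0 Cb_gt0 sigma_gt1 Ls_ge0 H_ge0 ei0 Lk_le) _.
rewrite lerD2l mulrA -sqrtrM ?mulr_ge0 //.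
have -> : H * eps^-1 * (Cb * (sigma - 1) / eps) = Cb * H * (sigma - 1) / eps ^+ 2.
  by field; rewrite lt0r_neq0.
rewrite sqrt_div ?sqr_ge0 //; last by rewrite !mulr_ge0 ?subr_ge0 ?(ltW Cb_gt0) ?(ltW sigma_gt1).
by rewrite sqrtr_sqr gtr0_norm // invfM le_eqVlt; apply/orP; left; apply/eqP; ring.
Qed.

(** Serves both choices of the tolerances, which differ only in the bound [M] on the logarithms. *)
Lemma total_strong (mu M : R) : 0 < mu -> 0 <= M ->
  (forall k, (k < K)%N -> (T k)%:R <= 1 + 2 * Num.sqrt (Lk k / mu) * M) ->
  \sum_(k < K) (T k)%:R <= 2 * M
    * (K%:R * Num.sqrt (Ls / mu)
       + Num.sqrt (H / mu) * (Num.sqrt (Cb * (sigma - 1))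
           / (Num.sqrt eps * (Num.sqrt sigma - 1)))) + K%:R.
Proof.
move=> mu0 M0 /sum_one_plus/le_trans; apply; rewrite lerD2r.
have -> : \sum_(k < K) 2 * Num.sqrt (Lk k / mu) * M =
    2 * M * \sum_(k < K) Num.sqrt (Lk k * mu^-1).
  by rewrite mulr_sumr; apply: eq_bigr => k _; rewrite mulrAC.
apply: ler_wpM2l; first by rewrite mulr_ge0.
have mi0 : 0 <= mu^-1 by rewrite invr_ge0 ltW.
apply: le_trans (sum_sqrt_lipschitz eps_gt0 K_gt0 Cb_gt0 sigma_gt1 Ls_ge0 H_ge0 mi0 Lk_le) _.
have -> : Num.sqrt (Cb * (sigma - 1) / eps) = Num.sqrt (Cb * (sigma - 1)) / Num.sqrt eps.
  by rewrite sqrt_div ?(ltW eps_gt0) // mulr_ge0 ?subr_ge0 // ltW.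
by rewrite invfM le_eqVlt; apply/orP; left; apply/eqP; ring.
Qed.

Lemma total_split_convex :
  (forall k, (k < K)%N -> (T k)%:R <= 1 + D * Num.sqrt (2 * Lk k /
     (Ce / 2 / (beta k `^ (1 / 3) * \sum_(t < K) beta t `^ (2 / 3))))) ->
  \sum_(k < K) (T k)%:R <= 2 * D * Num.sqrt (Cb / Ce)
    * (Num.sqrt (Ls / eps)
       * ((sigma - 1) `^ (1 / 2)
          / ((sigma `^ (1 / 6) - 1) * (sigma `^ (2 / 3) - 1) `^ (1 / 2)))
       + Num.sqrt (H * Cb) * (sigma - 1)
         / (eps * (sigma `^ (2 / 3) - 1) `^ (3 / 2))) + K%:R.
Proof.
move=> /sum_one_plus/le_trans; apply; rewrite lerD2r.
set S := \sum_(t < K) _.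
have Ce0 := ltW Ce_gt0; have Cb0 := ltW Cb_gt0; have eps0 := ltW eps_gt0.
have S0 : 0 < S.
  rewrite lt_neqAle sumr_ge0 ?andbT => [|t _]; last exact: powR_ge0.
  rewrite eq_sym psumr_neq0 => [|t _]; last exact: powR_ge0.
  by apply/hasP; exists (Ordinal K_gt0); rewrite ?mem_index_enum //= powR_gt0.
have -> : \sum_(k < K) D * Num.sqrt (2 * Lk k / (Ce / 2 / (beta k `^ (1 / 3) * S)))
   = 2 * D / Num.sqrt Ce * \sum_(k < K) Num.sqrt (Lk k * (beta k `^ (1 / 3) * S)).
  rewrite mulr_sumr; apply: eq_bigr => k _.
  have p0 := powR_gt0 (1 / 3) (b_gt0 k).
  have -> : 2 * Lk k / (Ce / 2 / (beta k `^ (1 / 3) * S)) =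
      2 ^+ 2 * ((Lk k * (beta k `^ (1 / 3) * S)) / Ce).
    by field; rewrite !lt0r_neq0.
  rewrite (sqrtrM _ (sqr_ge0 _)) sqrtr_sqr ger0_norm // sqrt_div //; last first.
    by rewrite !mulr_ge0 ?(ltW S0) ?(ltW p0) // Lk_ge0.
  by ring.
have c0 : 0 <= 2 * D / Num.sqrt Ce by rewrite !mulr_ge0 // invr_ge0 sqrtr_ge0.
apply: le_trans (ler_wpM2l c0 (sum_sixth_roots eps_gt0 K_gt0 Cb_gt0 sigma_gt1
  Ls_ge0 H_ge0 Lk_le)) _.
have s0 : 0 <= sigma - 1 by rewrite subr_ge0 ltW.
have s23 : 0 <= sigma `^ (2 / 3) - 1.
  rewrite subr_ge0; apply: (@le_trans _ _ (1 `^ (2 / 3))); first by rewrite powR1.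
  by apply: ge0_ler_powR; rewrite ?nnegrE ?(ltW sigma_gt1) ?(le_trans ler01 (ltW sigma_gt1)) //; lra.
have half (y : R) : 0 <= y -> y `^ (1 / 2) = Num.sqrt y.
  by move=> y0; rewrite div1r powR12_sqrt.
rewrite !half // (sqrt_div Cb0 Ce0) (sqrt_div Ls_ge0 eps0) (sqrtrM _ H_ge0).
rewrite (sqrt_div _ eps0) ?mulr_ge0 // (sqrtrM _ Cb0) !invfM.
move: (Num.sqrt Cb) (sqr_sqrtr Cb0) => s cc; rewrite -cc.
by rewrite le_eqVlt; apply/orP; left; apply/eqP; ring.
Qed.

Section Logarithms.
Variables (mu : R) (k : nat).
Hypotheses (mu_gt0 : 0 < mu) (kK : (k < K)%N) (Lk_gt0 : 0 < Lk k) (D_gt0 : 0 < D).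
(** By [beta_last] this is [Ls + mu] plus [H] times the largest penalty, so it dominates every
    [Lk k]. *)
Let Y := Ls + mu + H * (Cb * (sigma - 1) + betag * eps) / (sigma * eps).

Let Lk_leY : Lk k <= Y.
Proof.
rewrite /Y -mulrA -(beta_last Cb eps_gt0 K_gt0 sigma_gt1) -/betag -/(beta _).
apply: le_trans (Lk_le kK) _.
have := ler_wpM2r H_ge0 (beta_le eps_gt0 K_gt0 Cb_gt0 sigma_gt1 kK).
by rewrite -/betag -/(beta _) -/(beta _); have := mu_gt0; lra.
Qed.

Let Y_gt0 : 0 < Y. Proof. exact: lt_le_trans Lk_leY. Qed.

Let X_gt0 : 0 < Cb * D ^+ 2 / (eps * Ce).
Proof. by rewrite divr_gt0 ?mulr_gt0 ?exprn_gt0. Qed.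

Lemma log_const : ln (Lk k * D ^+ 2 / (2 * (eps / 2 * (Ce / Cb)))) <=
  ln (Cb * D ^+ 2 / (eps * Ce)) + ln Y.
Proof.
have A0 : 0 < Lk k * D ^+ 2 / (2 * (eps / 2 * (Ce / Cb))).
  by rewrite !(mulr_gt0, divr_gt0, invr_gt0, exprn_gt0).
have B0 := mulr_gt0 X_gt0 Y_gt0.
rewrite -lnM ?posrE // ler_ln ?posrE //.
have -> : Lk k * D ^+ 2 / (2 * (eps / 2 * (Ce / Cb))) =
    Cb * D ^+ 2 / (eps * Ce) * Lk k by field; rewrite !lt0r_neq0.
by rewrite ler_pM2l.
Qed.

Lemma log_split :
  ln (Lk k * D ^+ 2 / (2 * (Ce / 2 / (Num.sqrt (beta k) * \sum_(t < K) Num.sqrt (beta t))))) <=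
  ln (Cb * D ^+ 2 / (eps * Ce)) + ln Y
  + ln (Num.sqrt ((sigma - 1) ^+ 2 + betag * eps * (sigma - 1) / Cb)
        / (sigma - Num.sqrt sigma)).
Proof.
have sb t : 0 < Num.sqrt (beta t) by rewrite sqrtr_gt0.
set S := \sum_(t < K) _.
have S0 : 0 < S.
  rewrite lt_neqAle sumr_ge0 ?andbT => [|t _]; last exact: ltW.
  rewrite eq_sym psumr_neq0 => [|t _]; last exact: ltW.
  by apply/hasP; exists (Ordinal K_gt0); rewrite ?mem_index_enum //=.
have := last_sqrt_beta eps_gt0 K_gt0 Cb_gt0 sigma_gt1.
rewrite -/betag -/(beta _) -/S; set V := _ / (_ - _) => h.
have h2 : Num.sqrt (beta k) * S <= Cb / eps * V.
  apply: le_trans h; apply: (ler_wpM2r (ltW S0)); apply: ler_wsqrtr.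
  exact: (beta_le eps_gt0 K_gt0 Cb_gt0 sigma_gt1 kK).
have V0 : 0 < V.
  have := lt_le_trans (mulr_gt0 (sb k) S0) h2.
  by rewrite pmulr_rgt0 // divr_gt0.
have A0 : 0 < Lk k * D ^+ 2 / (2 * (Ce / 2 / (Num.sqrt (beta k) * S))).
  by rewrite !(mulr_gt0, divr_gt0, invr_gt0, exprn_gt0).
have B0 := mulr_gt0 X_gt0 Y_gt0; have BV0 := mulr_gt0 B0 V0.
rewrite -!lnM ?posrE // ler_ln ?posrE //.
have -> : Lk k * D ^+ 2 / (2 * (Ce / 2 / (Num.sqrt (beta k) * S))) =
    D ^+ 2 / Ce * (Lk k * (Num.sqrt (beta k) * S)).
  by field; rewrite !lt0r_neq0.
have -> : Cb * D ^+ 2 / (eps * Ce) * Y * V = D ^+ 2 / Ce * (Y * (Cb / eps * V)).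
  by field; rewrite !lt0r_neq0.
rewrite ler_pM2l ?divr_gt0 ?exprn_gt0 //.
by apply: ler_pM => //; rewrite ?mulr_ge0 ?(ltW (sb _)) ?(ltW S0) ?(ltW Lk_gt0).
Qed.

End Logarithms.
End Totals.

(** * The Euclidean diameter of a bounded set *)

Section Diameter.
Context {R : realType} {n : nat}.
Implicit Types (x y : 'rV[R]_n) (S : set 'rV[R]_n).

Lemma enorm_le_norm x : enorm x <= Num.sqrt n%:R * `|x|.
Proof.
rewrite -{1}(ger0_norm (normr_ge0 x)) -sqrtr_sqr -sqrtrM ?ler0n //.
apply: ler_wsqrtr; rewrite -[X in X%:R]card_ord -sum1_card natr_sum mulr_suml.
apply: ler_sum => j _; rewrite mul1r -[leLHS]real_normK ?num_real //.
rewrite ler_sqr ?nnegrE //.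
have -> : `|x| = mx_norm x by [].
rewrite mx_normrE.
exact: (le_bigmax _ (fun ij => `|x ij.1 ij.2|) (ord0, j)).
Qed.

(** The real supremum is an upper bound only once the distances are known to be bounded. Boundedness
    refers to the sup norm, whence the factor [Num.sqrt n%:R]. *)
Lemma le_diameter S x y : bounded_set S -> S x -> S y ->
  enorm (x - y) <= diameter S.
Proof.
move=> [M [_ HM]] Sx Sy; apply: ub_le_sup; last by exists x, y.
exists (Num.sqrt n%:R * ((M + 1) + (M + 1))) => _ [u [v [Su Sv ->]]].
have M1 : M < M + 1 by rewrite ltrDl.
apply: le_trans (enorm_le_norm _) _; rewrite ler_wpM2l ?sqrtr_ge0 //.
apply: le_trans (ler_normB _ _) _.
by apply: lerD; apply: (HM _ M1).
Qed.

End Diameter.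

(** * Assembly of the error bounds and of the gradient evaluation counts *)

Theorem theorem9 (R : realType) (n m : nat)
  (X : set 'rV[R]_n) (g : 'rV[R]_n -> R) (h : 'rV[R]_n -> \bar R)
  (f : 'I_m -> 'rV[R]_n -> R)
  (L0 : R) (L B : 'I_m -> R) (mu : R)
  (X_closed : closed X) (X_convex : convex_set X)
  (g_convex : convex_differentiable g)
  (h_convex : convex_ext h)
  (f_convex : forall i, convex_differentiable (f i))
  (mu_ge0 : 0 <= mu) (g_strong : strongly_convex mu g)
  (S_bounded : bounded_set (edom h `&` X))
  (g_lip : lipschitz_grad (edom h `&` X) g L0)
  (f_lip : forall i, lipschitz_grad (edom h `&` X) (f i) (L i))
  (B_bound : forall i x, (edom h `&` X) x ->
     Num.max `|f i x| (enorm (grad (f i) x)) <= B i)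
  (B_lip : forall i x y, (edom h `&` X) x -> (edom h `&` X) y ->
     `|f i x - f i y| <= B i * enorm (x - y))
  (xs : 'rV[R]_n) (zs : 'rV[R]_m) (KKT : is_KKT g h f X xs zs)
  (eps Cb Ce sigma : R) (K : nat)
  (eps_gt0 : 0 < eps) (K_gt0 : (0 < K)%N) (Cb_gt0 : 0 < Cb) (Ce_gt0 : 0 < Ce)
  (sigma_gt1 : 1 < sigma) :
  let D := diameter (edom h `&` X) in
  let H := \sum_(i < m) B i * (B i + L i) in
  let Ls := L0 + enorm (\row_(i < m) L i) * (2 * enorm zs + Num.sqrt Ce) in
  let betag := Cb / eps * ((sigma - 1) / (sigma ^+ K - 1)) in
  let beta := fun k : nat => betag * sigma ^+ k in
  let rho := beta in
  let choice1 := fun e : nat -> R =>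
    forall k, (k < K)%N -> e k = eps / 2 * (Ce / Cb) in
  let choice2 := fun e : nat -> R =>
    forall k, (k < K)%N -> e k =
      if mu == 0
      then Ce / 2 / (beta k `^ (1 / 3) * \sum_(t < K) beta t `^ (2 / 3))
      else Ce / 2 / (Num.sqrt (beta k) * \sum_(t < K) Num.sqrt (beta t)) in
  let G := ln (Cb * D ^+ 2 / (eps * Ce))
    + ln (Ls + mu + H * (Cb * (sigma - 1) + betag * eps) / (sigma * eps)) in
  let G' := G + ln (Num.sqrt ((sigma - 1) ^+ 2 + betag * eps * (sigma - 1) / Cb)
                    / (sigma - Num.sqrt sigma)) in
  forall (epsk : nat -> R) (x : nat -> 'rV[R]_n) (z : nat -> 'rV[R]_m),
  choice1 epsk \/ choice2 epsk ->
  is_iALM g h f X K beta rho epsk x z -> z 0%N = 0 ->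
  [/\ (`|objective g h (x K) - objective g h xs| <=
         (eps / 2 * (Ce / Cb)
          + eps * sigma / (Cb * (sigma - 1)) * (2 * enorm zs + Num.sqrt Ce)
            * (5 * enorm zs + 7 / 2 * Num.sqrt Ce))%:E)%E,
      enorm (\row_(i < m) Num.max (f i (x K)) 0) <=
        eps * sigma / (Cb * (sigma - 1))
        * (5 * enorm zs + 7 / 2 * Num.sqrt Ce)
    & let phi := fun k => smooth_part g f (beta k) (z k) in
      let psi := fun v => (h v + indicator X v)%E in
      let Lphi := fun k =>
        L0 + \sum_(i < m) (beta k * B i * (B i + L i) + L i * `|z k 0 i|) in
      let target := fun k =>
        eps_solution X (aug_lagrangian g h f (beta k) (z k)) (epsk k) in
      mu <= L0 / 4 ->
      forall w hw : nat -> nat -> 'rV[R]_n,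
      (forall k, (k < K)%N ->
        [/\ w k 0%N = x k,
            nesterov_run (phi k) psi (Lphi k) mu (target k) (w k) (hw k),
            smooth_along (phi k) (Lphi k) (target k) (edom h `&` X)
              (w k) (hw k)
          & forall j, stops_at (target k) (w k) j -> x k.+1 = w k j]) ->
      exists T : nat -> nat,
        (forall k, (k < K)%N -> stops_at (target k) (w k) (T k)) /\
        let TK : int := (\sum_(k < K) T k)%N%:Z in
        [/\ choice1 epsk -> mu = 0 ->
              TK <= Num.ceil
                (2 * D * Num.sqrt (Cb / Ce)
                 * (K%:R * Num.sqrt (Ls / eps)
                    + Num.sqrt (Cb * H * (sigma - 1))
                      / (eps * (Num.sqrt sigma - 1)))
                 + K%:R),
            choice1 epsk -> 0 < mu ->
              TK <= Num.ceil
                (2 * Num.max 0 G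
                 * (K%:R * Num.sqrt (Ls / mu)
                    + Num.sqrt (H / mu)
                      * (Num.sqrt (Cb * (sigma - 1))
                         / (Num.sqrt eps * (Num.sqrt sigma - 1))))
                 + K%:R),
            choice2 epsk -> mu = 0 ->
              TK <= Num.ceil
                (2 * D * Num.sqrt (Cb / Ce)
                 * (Num.sqrt (Ls / eps)
                    * ((sigma - 1) `^ (1 / 2)
                       / ((sigma `^ (1 / 6) - 1)
                          * (sigma `^ (2 / 3) - 1) `^ (1 / 2)))
                    + Num.sqrt (H * Cb) * (sigma - 1)
                      / (eps * (sigma `^ (2 / 3) - 1) `^ (3 / 2)))
                 + K%:R)
          & choice2 epsk -> 0 < mu ->
              TK <= Num.ceil
                (2 * Num.max 0 G'
                 * (K%:R * Num.sqrt (Ls / mu)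
                    + Num.sqrt (H / mu)
                      * (Num.sqrt (Cb * (sigma - 1))
                         / (Num.sqrt eps * (Num.sqrt sigma - 1))))
                 + K%:R)]].
Proof.
move=> D H Ls betag beta rho choice1 choice2 G G' epsk x z eE run z0.
have b0 : forall k, 0 < beta k := beta_gt0 eps_gt0 K_gt0 Cb_gt0 sigma_gt1.
have Ce0 := ltW Ce_gt0.
(* These three facts are all that the error bounds use about the tolerances. *)
have [e_gt0 e_sum e_last] : [/\ forall k, (k < K)%N -> 0 < epsk k,
    2 * \sum_(k < K) beta k * epsk k <= Ce & epsk K.-1 <= eps / 2 * (Ce / Cb)].
  case: eE => [e1|e2].
    have lastK : (K.-1 < K)%N by rewrite prednK.
    split; last by rewrite (e1 _ lastK).
      by move=> k kK; rewrite (e1 k kK) !(mulr_gt0, divr_gt0, invr_gt0).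
    exact: const_tolerance_sum eps_gt0 K_gt0 Cb_gt0 sigma_gt1 _ e1.
  have [mu0|mu_neq0] := boolP (mu == 0).
    have {}e2 k : (k < K)%N -> epsk k =
        Ce / 2 / (beta k `^ (1 / 3) * \sum_(t < K) beta t `^ (2 / 3)).
      by move=> kK; rewrite (e2 k kK) mu0.
    have a0 k : 0 < beta k `^ (1 / 3) by rewrite powR_gt0.
    have acE k : beta k `^ (1 / 3) * beta k `^ (2 / 3) = beta k.
      rewrite -powRD ?(gt_eqF (b0 k)) ?implybT //.
      by rewrite (_ : 1 / 3 + 2 / 3 = 1) ?powRr1 ?(ltW (b0 k)) //; lra.
    have a_le k : (k < K)%N -> beta k `^ (1 / 3) <= beta K.-1 `^ (1 / 3).
      move=> kK; apply: ge0_ler_powR; rewrite ?nnegrE ?(ltW (b0 _)) ?divr_ge0 //.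
      exact: (beta_le eps_gt0 K_gt0 Cb_gt0 sigma_gt1 kK).
    split.
    - exact: (split_tolerance_gt0 eps_gt0 K_gt0 Cb_gt0 Ce_gt0 sigma_gt1 a0 acE e2).
    - exact: (split_tolerance_sum eps_gt0 K_gt0 Cb_gt0 sigma_gt1 a0 acE e2).
    - exact: (split_tolerance_last eps_gt0 K_gt0 Cb_gt0 Ce_gt0 sigma_gt1 a0 acE a_le e2).
  have {}e2 k : (k < K)%N -> epsk k =
      Ce / 2 / (Num.sqrt (beta k) * \sum_(t < K) Num.sqrt (beta t)).
    by move=> kK; rewrite (e2 k kK) (negbTE mu_neq0).
  have a0 k : 0 < Num.sqrt (beta k) by rewrite sqrtr_gt0.
  have acE k : Num.sqrt (beta k) * Num.sqrt (beta k) = beta k.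
    by rewrite -expr2 sqr_sqrtr // (ltW (b0 k)).
  have a_le k : (k < K)%N -> Num.sqrt (beta k) <= Num.sqrt (beta K.-1).
    move=> kK; apply: ler_wsqrtr.
    exact: (beta_le eps_gt0 K_gt0 Cb_gt0 sigma_gt1 kK).
  split.
  - exact: (split_tolerance_gt0 eps_gt0 K_gt0 Cb_gt0 Ce_gt0 sigma_gt1 a0 acE e2).
  - exact: (split_tolerance_sum eps_gt0 K_gt0 Cb_gt0 sigma_gt1 a0 acE e2).
  - exact: (split_tolerance_last eps_gt0 K_gt0 Cb_gt0 Ce_gt0 sigma_gt1 a0 acE a_le e2).
have e_ge0 k : (k < K)%N -> 0 <= epsk k by move=> kK; exact: ltW (e_gt0 k kK).
have c_gt0 : 0 < eps * sigma / (Cb * (sigma - 1)).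
  have s0 : 0 < sigma by exact: lt_trans sigma_gt1.
  by rewrite !(mulr_gt0, divr_gt0, invr_gt0) // subr_gt0.
have b_last := beta_last_ge eps_gt0 K_gt0 Cb_gt0 sigma_gt1.
have x_dom := iALM_dom h_convex KKT run.
have zs0 := enorm_ge0 zs; have sC0 := sqrtr_ge0 Ce.
split.
- rewrite (objectiveE _ h_convex (x_dom K (leqnn K)).1).
  rewrite (objectiveE _ h_convex (KKT_dom KKT).1) -EFinB /= lee_fin.
  exact: (iALM_objective h_convex f_convex KKT b0 e_ge0 Ce0 e_sum run z0
    c_gt0 K_gt0 b_last e_last).
- apply: le_trans (iALM_feasible h_convex f_convex KKT b0 e_ge0 Ce0 e_sum run z0
    c_gt0 K_gt0 b_last) _.
  by apply: ler_wpM2l; [exact: ltW|lra].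
move=> phi psi Lphi target mu_le w hw Hw.
have diam u v := @le_diameter _ _ _ u v S_bounded.
have D0 : 0 <= D by apply: le_trans (diam _ _ (KKT_dom KKT) (KKT_dom KKT)); exact: enorm_ge0.
have sum_ceil (T : nat -> nat) (y : R) : \sum_(k < K) (T k)%:R <= y ->
    (\sum_(k < K) T k)%N%:Z <= Num.ceil y.
  move=> Ty; rewrite -(ler_int R); apply: le_trans (ceil_ge y).
  by rewrite -[leLHS]/((\sum_(k < K) T k)%N%:R) natr_sum.
have max_ge0 (M : R) : 0 <= Num.max 0 M by rewrite le_max lexx.
(* If [D = 0] the domain is a single point, which solves every subproblem at once, so [T = 0]. The
   case is split off because the logarithmic estimates need [D > 0]. *)
have [Deq0|D_neq0] := eqVneq D 0.
  have single u v : (edom h `&` X) u -> (edom h `&` X) v -> u = v.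
    move=> Su Sv; apply/eqP; rewrite -subr_eq0; apply/eqP/enorm_eq0/eqP.
    by rewrite eq_le enorm_ge0 -Deq0 diam.
  exists (fun=> 0%N); split=> [k kK|].
    split=> [|//]; have [-> _ _ _] := Hw k kK.
    apply/(aug_solutionP h_convex KKT); have Sx := x_dom k (ltnW kK).
    by split=> // u Su; rewrite (single u _ Su Sx) lerDl e_ge0.
  have s0 : 0 <= Num.sqrt sigma - 1.
    by rewrite subr_ge0 -[leLHS]sqrtr1 ler_wsqrtr // ltW.
  have strong_ge0 M : 0 <= 2 * Num.max 0 M * (K%:R * Num.sqrt (Ls / mu)
      + Num.sqrt (H / mu) * (Num.sqrt (Cb * (sigma - 1))
        / (Num.sqrt eps * (Num.sqrt sigma - 1)))).
    apply: mulr_ge0; first by rewrite mulr_ge0.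
    apply: addr_ge0; first by rewrite mulr_ge0 ?sqrtr_ge0.
    apply: mulr_ge0; first exact: sqrtr_ge0.
    by rewrite divr_ge0 ?sqrtr_ge0 // mulr_ge0 ?sqrtr_ge0.
  split=> _ _; apply: (sum_ceil (fun=> 0%N)); rewrite big1 //.
  + by rewrite Deq0 mulr0 !mul0r add0r.
  + by rewrite addr_ge0 ?strong_ge0.
  + by rewrite Deq0 mulr0 !mul0r add0r.
  + by rewrite addr_ge0 ?strong_ge0.
have D_gt0 : 0 < D by rewrite lt_neqAle eq_sym D_neq0.
(* Two distinct points of the domain force all Lipschitz constants to be nonnegative. *)
have [a [b [Sa Sb ab]]] : exists a b,
    [/\ (edom h `&` X) a, (edom h `&` X) b & 0 < enorm (a - b)].
  have ne : [set d | exists x y, [/\ (edom h `&` X) x, (edom h `&` X) y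
      & d = enorm (x - y)]] !=set0.
    by exists (enorm (xs - xs)), xs, xs; split=> //; exact: KKT_dom KKT.
  have [_ [a [b [Sa Sb ->]]] ab] := sup_gt ne D_gt0.
  by exists a, b.
have lip_ge0 F l : lipschitz_grad (edom h `&` X) F l -> 0 <= l.
  move=> /(_ a b Sa Sb) Fl; rewrite -(pmulr_lge0 _ ab).
  by apply: le_trans Fl; exact: enorm_ge0.
have L0_ge0 := lip_ge0 _ _ g_lip.
have L_ge0 i := lip_ge0 _ _ (f_lip i).
have B_ge0 i : 0 <= B i.
  apply: le_trans (B_bound i _ (KKT_dom KKT)).
  by rewrite le_max normr_ge0.
have H_ge0 : 0 <= H.
  by apply: sumr_ge0 => i _; rewrite mulr_ge0 ?addr_ge0.
have Ls_ge0 : 0 <= Ls.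
  by rewrite addr_ge0 // mulr_ge0 ?enorm_ge0 // addr_ge0 // mulr_ge0.
have LphiE k : Lphi k = L0 + beta k * H + \sum_(i < m) L i * `|z k 0 i|.
  rewrite /Lphi big_split /= addrA; congr (_ + _ + _).
  by rewrite mulr_sumr; apply: eq_bigr => i _; rewrite mulrA.
(* Since the multipliers are nonnegative, Cauchy-Schwarz with their uniform norm bound turns the
   last sum of [LphiE] into the second summand of [Ls]. *)
have Lphi_le k : (k < K)%N -> Lphi k <= Ls + beta k * H.
  move=> kK; rewrite LphiE /Ls -!addrA lerD2l [leRHS]addrC lerD2l.
  have zk := iALM_multiplier h_convex f_convex KKT b0 e_ge0 Ce0 e_sum run z0 (ltnW kK).
  apply: le_trans (ler_wpM2l (enorm_ge0 _) zk).
  apply: le_trans (cauchy_schwarz _ _).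
  apply: ler_sum => i _; rewrite mxE ger0_norm //.
  exact: (iALM_multiplier_ge0 b0 run z0 i (ltnW kK)).
have Lphi_ge k : L0 <= Lphi k.
  rewrite LphiE -addrA lerDl; apply: addr_ge0.
    by apply: mulr_ge0 => //; exact: ltW (b0 k).
  by apply: sumr_ge0 => i _; rewrite mulr_ge0.
have mu_Lphi k : mu <= Lphi k.
  by apply: le_trans (Lphi_ge k); apply: le_trans mu_le _; lra.
have phi_grad k := smooth_part_grad g_convex.2 g_strong f_convex (b0 k) (z k).
have FeS k v : (edom h `&` X) v -> aug_lagrangian g h f (beta k) (z k) v =
    (smooth_part g f (beta k) (z k) v + fine (h v))%:E.
  by move=> [hv _]; exact: aug_lagrangianE.
have FeNS k v := @aug_lagrangian_out _ _ _ g h f (beta k) (z k) v.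
(* The condition [k < K] stands inside the existential so that [choice] yields a function on all
   indices; the value 0 beyond [K] is a default. *)
have stops k : exists T, (k < K)%N -> stops_at (target k) (w k) T /\
    (mu = 0 -> T%:R <= 1 + D * Num.sqrt (2 * Lphi k / epsk k)) /\
    (0 < mu -> T%:R <= 1 + 2 * Num.sqrt (Lphi k / mu)
       * Num.max 0 (ln (Lphi k * D ^+ 2 / (2 * epsk k)))).
  have [kK|nkK] := boolP (k < K)%N; last by exists 0%N.
  have [wx wrun wsm _] := Hw k kK.
  have Sw0 : (edom h `&` X) (w k 0%N) by rewrite wx; exact: x_dom (ltnW kK).
  have [mu0|mu_neq0] := eqVneq mu 0.
    have [T [TT TM]] := nesterov_stops_convex h_convex X_convex mu_ge0 (mu_Lphi k)
      (e_gt0 k kK) (phi_grad k) diam (FeS k) (FeNS k) Sw0 wrun wsm mu0.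
    by exists T => _; split=> //; split=> // /gt_eqF; rewrite mu0 eqxx.
  have mu_gt0 : 0 < mu by rewrite lt_neqAle eq_sym mu_neq0.
  have [T [TT TM]] := nesterov_stops_strong h_convex X_convex mu_ge0 (mu_Lphi k)
    (e_gt0 k kK) (phi_grad k) diam (FeS k) (FeNS k) Sw0 wrun wsm mu_gt0 (lexx _).
  by exists T => _; split=> //; split=> // mu0; rewrite mu0 eqxx in mu_neq0.
have [T TP] := choice stops.
exists T; split=> [k kK|]; first by have [] := TP k kK.
have Lphi_ge0 k : (k < K)%N -> 0 <= Lphi k.
  by move=> _; exact: le_trans mu_ge0 (mu_Lphi k).
(* A negative logarithm still permits one iteration per subproblem, hence the positive part;
   monotonicity then replaces each logarithm by the common bound [M]. *)
have strong M : 0 < mu -> (forall k, (k < K)%N ->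
    ln (Lphi k * D ^+ 2 / (2 * epsk k)) <= M) ->
    forall k, (k < K)%N -> (T k)%:R <= 1 + 2 * Num.sqrt (Lphi k / mu) * Num.max 0 M.
  move=> mu0 lnM k kK; have [_ [_ /(_ mu0)]] := TP k kK.
  move/le_trans; apply; rewrite lerD2l ler_wpM2l ?mulr_ge0 ?sqrtr_ge0 //.
  by rewrite ge_max le_max lexx /= le_max lnM ?orbT.
split=> [e1 mu0|e1 mu0|e2 mu0|e2 mu0]; apply: sum_ceil.
- apply: (total_const_convex eps_gt0 K_gt0 Cb_gt0 Ce_gt0 sigma_gt1 Ls_ge0 H_ge0
    Lphi_le D0) => k kK.
  by have [_ [/(_ mu0) + _]] := TP k kK; rewrite (e1 k kK).
- apply: (total_strong eps_gt0 K_gt0 Cb_gt0 sigma_gt1 Ls_ge0 H_ge0 Lphi_le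
    mu0 (max_ge0 G)).
  apply: strong => // k kK; rewrite (e1 k kK).
  have Lk_gt0 : 0 < Lphi k := lt_le_trans mu0 (mu_Lphi k).
  exact: (log_const eps_gt0 K_gt0 Cb_gt0 Ce_gt0 sigma_gt1 H_ge0 Lphi_le mu0 kK
    Lk_gt0 D_gt0).
- apply: (total_split_convex eps_gt0 K_gt0 Cb_gt0 Ce_gt0 sigma_gt1 Ls_ge0 H_ge0
    Lphi_le Lphi_ge0 D0) => k kK.
  by have [_ [/(_ mu0) + _]] := TP k kK; rewrite (e2 k kK) mu0 eqxx.
- apply: (total_strong eps_gt0 K_gt0 Cb_gt0 sigma_gt1 Ls_ge0 H_ge0 Lphi_le
    mu0 (max_ge0 G')).
  apply: strong => // k kK; rewrite (e2 k kK) gt_eqF //.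
  have Lk_gt0 : 0 < Lphi k := lt_le_trans mu0 (mu_Lphi k).
  exact: (log_split eps_gt0 K_gt0 Cb_gt0 Ce_gt0 sigma_gt1 H_ge0 Lphi_le mu0 kK
    Lk_gt0 D_gt0).
Qed.
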